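(* Let $K$ be an $o$-symmetric convex domain in $\mathbb{E}^2$, and let $n > 1$ and $\lambda \geq 0$ be given. If $\{ c_1 + K^{\lambda}, c_2 + K^{\lambda}, \ldots, c_n + K^{\lambda} \} \in \mathcal{P}^{sep}_{K,n,\lambda}$, then $$\operatorname{area} \left( \operatorname{conv} \left( \bigcup_{i=1}^n (c_i + K^{\lambda}) \right) \right) \geq (n-1)\operatorname{area} \left(\square(K)\right)+2\lambda A(\operatorname{conv} \{c_1,c_2,\ldots,c_n \}, K)+(1+\lambda)^2 \operatorname{area} (K)$$ $$\geq \left( n-1 + \frac{\lambda}{4} M_K\left(\operatorname{bd}(\operatorname{conv} \{ c_1,c_2,\ldots, c_n\})\right) \right) \operatorname{area} \left(\square(K)\right) + (1+\lambda)^2 \operatorname{area}(K).$$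
   Context: $\mathbb{E}^2$ is the Euclidean plane with origin $o$. A convex domain is a compact convex set with non-empty interior in $\mathbb{E}^2$; it is $o$-symmetric if $K=-K$. A family of translates of $K$ is a packing if no two members have an interior point in common; a packing $\mathcal F$ of translates of $K$ is totally separable if any two members of $\mathcal F$ can be separated by a line which is disjoint from the interiors of all members of $\mathcal F$. For $\lambda\ge 0$, $K^\lambda=(1+\lambda)K$ (the soft domain with hard core $K$ and soft parameter $\lambda$). The family $\{c_1+K^\lambda,\dots,c_n+K^\lambda\}$ is a totally separable soft packing of $n$ translates of $K^\lambda$ if $\{c_1+K,\dots,c_n+K\}$ is a totally separable packing; $\mathcal{P}^{sep}_{K,n,\lambda}$ is the family of all totally separable soft packings of $n$ translates of $K^\lambda$. $\square(K)$ denotes a minimal area parallelogram circumscribed about $K$. $A(Q,K)$ denotes the mixed area of the compact convex sets $Q$ and $K$, i.e. $\operatorname{area}(Q+K)=\operatorname{area}(Q)+2A(Q,K)+\operatorname{area}(K)$. $|x|_K=\min\{\mu : x\in\mu K\}$ is the norm generated by $K$, and $M_K(P)=\sum_i|x_i-x_{i-1}|_K$ is the Minkowski length of a polygonal curve $P=\bigcup_i[x_{i-1},x_i]$; $M_K(\operatorname{bd} Q)$ for a convex polygon $Q$ is the perimeter of $Q$ in this norm. If $Q$ degenerates to a segment, $\operatorname{bd} Q$ is regarded as the closed curve traversing the segment twice, so $M_K(\operatorname{bd} Q)$ is twice the normed length of the segment. *)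

(* Defs.v *)
From HB Require Import structures.
From mathcomp Require Import all_boot all_order all_algebra.
From mathcomp Require Import all_classical all_reals all_analysis.

Set Implicit Arguments.
Unset Strict Implicit.
Unset Printing Implicit Defensive.

Import Order.TTheory GRing.Theory Num.Theory.
Import numFieldNormedType.Exports.

Local Open Scope classical_set_scope.
Local Open Scope ring_scope.

(* The library equips [R^o], rather than [R], with the module structure over
   [R]. *)
Notation plane R := (R^o * R^o)%type.

Section Plane.
Context {R : realType}.
Implicit Types (A B K Q P : set (plane R)) (x y z p q u v a c : plane R).

(* Every set measured here is compact, hence Borel and of finite measure. *)
Definition area A : R :=
  fine ((@lebesgue_measure R \x @lebesgue_measure R)%E A).

Definition dot u v : R := u.1 * v.1 + u.2 * v.2.
Definition det2 u v : R := u.1 * v.2 - u.2 * v.1.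

Definition chull A : set (plane R) := smallest (@convex_set R (plane R)) A.

Definition dilate (k : R) A : set (plane R) := [set k *: x | x in A].
Definition translate c A : set (plane R) := [set c + x | x in A].
Definition msum A B : set (plane R) := [set x + y | x in A & y in B].

Definition convex_domain K : Prop :=
  [/\ compact K, convex_set K & K° !=set0].

Definition o_symmetric K : Prop := K = [set - x | x in K].

Definition packing (I : Type) (F : I -> set (plane R)) : Prop :=
  forall i j, i <> j -> (F i)° `&` (F j)° = set0.

Definition line a (b : R) : set (plane R) := [set x | dot a x = b].

(* [F i] and [F j] lie in the two opposite closed half-planes of the line; the
   other choice of sides is obtained by replacing [(a, b)] by [(- a, - b)]. *)
Definition totally_separable (I : Type) (F : I -> set (plane R)) : Prop :=
  forall i j, i <> j -> exists (a : plane R) (b : R),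
    [/\ a <> 0,
        F i `<=` [set x | dot a x <= b],
        F j `<=` [set x | b <= dot a x] &
        forall k, line a b `&` (F k)° = set0].

Definition totally_separable_packing (I : Type) (F : I -> set (plane R)) :
  Prop := packing F /\ totally_separable F.

Definition soft (lambda : R) K : set (plane R) := dilate (1 + lambda) K.

Definition sep_soft_packings K (n : nat) (lambda : R) :
    set ('I_n -> set (plane R)) :=
  [set (fun i => translate (c i) (soft lambda K)) |
     c in [set c : 'I_n -> plane R |
             totally_separable_packing (fun i => translate (c i) K)]].

Definition parallelogram p u v : set (plane R) :=
  [set x | exists s t : R,
     [/\ 0 <= s <= 1, 0 <= t <= 1 & x = p + s *: u + t *: v]].

Definition segment p q : set (plane R) :=
  [set x | exists2 t : R, 0 <= t <= 1 & x = (1 - t) *: p + t *: q].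

(* Circumscribed means that [P] contains [K] and each side of [P] touches [K]. *)
Definition circumscribed_parallelogram K P : Prop :=
  exists p u v,
    [/\ det2 u v != 0, P = parallelogram p u v, K `<=` P &
        [/\ K `&` segment p (p + u) !=set0,
            K `&` segment p (p + v) !=set0,
            K `&` segment (p + u) (p + u + v) !=set0 &
            K `&` segment (p + v) (p + u + v) !=set0]].

Definition min_circumscribed_parallelogram K P : Prop :=
  circumscribed_parallelogram K P /\
  forall P', circumscribed_parallelogram K P' -> area P <= area P'.

Definition mixed_area Q K : R :=
  (area (msum Q K) - area Q - area K) / 2.

(* For a convex domain [K] symmetric about the origin the infimum is attained,
   i.e. it is a minimum. *)
Definition knorm K x : R := inf [set mu | 0 <= mu /\ dilate mu K x].

Definition extreme_point Q p : Prop :=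
  Q p /\ forall x y (t : R), Q x -> Q y -> 0 < t < 1 ->
    p = (1 - t) *: x + t *: y -> x = p /\ y = p.

(* The sides of a convex polygon [Q] as pairs (start, end), oriented so that
   [Q] lies on the left.  If [Q] is a segment, both of its orientations occur,
   so that its boundary is traversed twice. *)
Definition sides Q : set (plane R * plane R) :=
  [set e | [/\ e.1 <> e.2, extreme_point Q e.1, extreme_point Q e.2 &
               forall x, Q x -> 0 <= det2 (e.2 - e.1) (x - e.1)]].

(* The Minkowski length M_K(bd Q), for a convex polygon or a segment [Q]. *)
Definition mperimeter K Q : R :=
  \sum_(e \in sides Q) knorm K (e.2 - e.1).

End Plane.

(* Main.v *)
Require Import Defs.
From mathcomp Require Import all_boot all_order all_algebra.
From mathcomp Require Import all_classical all_reals all_analysis.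
From mathcomp Require Import measurable_realfun ring lra.

(** Let [w e = hwidth K e] be the maximum of the linear form [det2 e] over [K]:
    the support function of [K] turned by a right angle, which is a norm on the
    plane.  Two facts carry the proof.

    The first is the Steiner formula ([steiner]): if [Q] is the convex hull of
    a finite set, then area (Q + K) = area Q + area K + W, where [W] is the sum
    of [w] over the sides of [Q]; so 2 A(Q, K) = W.  Cutting [Q] by a line is
    compatible with area (Q + K) ([area_msum_cut]), so triangles can be cut off
    one after the other ([ear_cut], [ear_sides]).  A triangle, or a trapezoid,
    is half of a parallelogram ([excess_trapezoid]), and a parallelogram plus
    [K] arises from [K] by adding two segments, each of which adds its length
    times a width to the area ([area_msum_segment]).  The formula for the body
    t K, where t = 1 + lambda, reads
    area (Q + t K) = area Q + t W + t^2 area K, and the two inequalities of the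
    theorem become
      area Q + W >= (n - 1) area sq   and   4 W >= M_K(bd Q) area sq.

    The second fact is [circumscribed_area_le].  The parallelogram circumscribed
    about [K] with sides parallel to [d] and [u] has area
    4 w(d) w(u) / |det2 d u|, so area sq * |det2 d u| <= 4 w(d) w(u).  Taking all
    [d] together, duality turns this into area sq * |u|_K <= 4 w(u)
    ([knorm_le_hwidth]); summed over the sides of [Q] this is the second
    inequality.

    The first inequality says that area (Q + K) - area K, the [excess] of [Q],
    is at least (n - 1) area sq, and is proved by induction on the number of
    centres ([excess_totally_separable]).  A separating line of direction [d]
    splits the centres into two groups, and no centre lies in the open strip
    |det2 d x - b| < w(d) around it.  Cut [Q] along the two boundary lines of
    this strip.  The outer parts contain the hulls of the two groups.  The
    middle part contains the trapezoid spanned by the two chords, and in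
    [excess_trapezoid] the contribution of the parallel sides is exactly the
    excess of the two chords.  What is left is w(u) + w(u') for the two legs
    [u], [u'] of the trapezoid.  As they cross the strip, |det2 d u| = 2 w(d),
    and the second fact gives w(u) >= area sq / 2, likewise for [u']
    ([excess_strip]).  So each split gains area sq. *)

Set Implicit Arguments.
Unset Strict Implicit.
Unset Printing Implicit Defensive.

Import Order.TTheory GRing.Theory Num.Theory.
Import numFieldNormedType.Exports.
Local Open Scope classical_set_scope.
Local Open Scope ring_scope.

(* The Minkowski sum; the unqualified name is that of the sum of two measures. *)
Local Notation msum := Defs.msum.

Local Ltac plane_ring :=
  apply: injective_projections; rewrite /= /GRing.scale /=; ring.
Local Ltac plane_field :=
  apply: injective_projections; rewrite /= /GRing.scale /=; field.

(** * Coordinates and the determinant form *)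

Section Coordinates.
Context {R : realType}.
Implicit Types (A : set (plane R)) (x y z v e : plane R).

Lemma convexP A :
  convex_set A <-> forall x y (t : R), 0 <= t <= 1 -> A x -> A y ->
    A ((1 - t) *: x + t *: y).
Proof.
split => [cA x y t /andP[t0 t1] Ax Ay|cA x y l /set_mem Ax /set_mem Ay].
  have /set_mem := cA y x (Itv01 t0 t1) (mem_set Ay) (mem_set Ax).
  by rewrite /conv /= /conv /= addrC.
by apply/mem_set; rewrite /conv /= addrC; apply: cA => //; apply/andP.
Qed.

Lemma det2Dr e x y : det2 e (x + y) = det2 e x + det2 e y.
Proof. by rewrite /det2 /=; ring. Qed.

Lemma det2Nr e x : det2 e (- x) = - det2 e x.
Proof. by rewrite /det2 /=; ring. Qed.

Lemma det2Nl w x : det2 (- w) x = - det2 w x.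
Proof. by rewrite /det2 /=; ring. Qed.

Lemma det2Zr e (t : R) x : det2 e (t *: x) = t * det2 e x.
Proof. by rewrite /det2 /= /GRing.scale /=; ring. Qed.

Lemma det2Dl e x y : det2 (x + y) e = det2 x e + det2 y e.
Proof. by rewrite /det2 /=; ring. Qed.

Lemma det2Zl e (t : R) x : det2 (t *: x) e = t * det2 x e.
Proof. by rewrite /det2 /= /GRing.scale /=; ring. Qed.

Lemma det2_anti x y : det2 x y = - det2 y x.
Proof. by rewrite /det2; ring. Qed.

Lemma det2xx x : det2 x x = 0.
Proof. by rewrite /det2; ring. Qed.

Lemma eq_ler (a b : R) : a = b -> a <= b.
Proof. by move=> ->. Qed.

Lemma sqr_norm_gt0 v : v <> 0 -> 0 < v.1 ^+ 2 + v.2 ^+ 2.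
Proof.
move=> v0; rewrite lt_neqAle addr_ge0 ?sqr_ge0// andbT eq_sym.
apply: contra_notN v0; rewrite paddr_eq0 ?sqr_ge0// !sqrf_eq0.
by move=> /andP[/eqP ? /eqP ?]; apply: injective_projections.
Qed.

Lemma det2_coordinates x y z : det2 x y != 0 ->
  z = (det2 z y / det2 x y) *: x + (det2 x z / det2 x y) *: y.
Proof.
move=> D0; apply: injective_projections;
  by rewrite /det2 /= /GRing.scale /= in D0 *; field.
Qed.

Lemma det2_dot_eq0 v x : v <> 0 -> det2 v x = 0 -> dot v x = 0 -> x = 0.
Proof.
move=> /sqr_norm_gt0; set N := _ + _; rewrite /det2 /dot => N0 x1 x2.
have E1 : N * x.1 = 0.
  have -> : N * x.1 =
      v.1 * (v.1 * x.1 + v.2 * x.2) - v.2 * (v.1 * x.2 - v.2 * x.1).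
    by rewrite /N; ring.
  by rewrite x1 x2 !mulr0 subrr.
have E2 : N * x.2 = 0.
  have -> : N * x.2 =
      v.2 * (v.1 * x.1 + v.2 * x.2) + v.1 * (v.1 * x.2 - v.2 * x.1).
    by rewrite /N; ring.
  by rewrite x1 x2 !mulr0 addr0.
apply: injective_projections => /=; apply/eqP.
  by move/eqP: E1; rewrite mulf_eq0 gt_eqF.
by move/eqP: E2; rewrite mulf_eq0 gt_eqF.
Qed.

End Coordinates.

(** * Lebesgue measure in the plane *)

Section PlaneMeasure.
Context {R : realType}.
Implicit Types (A B K Q M P : set (plane R)) (x y z p q u v e : plane R).

Local Notation mu := (@lebesgue_measure R).
Local Notation mu2 := (mu \x mu)%E.
Local Notation mplane := (measurableTypeR R * measurableTypeR R)%type.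

Lemma affine_measurable (a b : R) :
  measurable_fun [set: measurableTypeR R]
    ((fun x : R => a * x + b) : measurableTypeR R -> measurableTypeR R).
Proof. by apply: measurable_funD => //; apply: measurable_funM. Qed.

(** A measure on the line is determined by its values on the intervals open on the
    left and closed on the right.  If [a] is negative, the preimage of such an
    interval is closed on the left instead, which has the same length. *)
Lemma lebesgue_affine (a b : R) (X : set R) : a != 0 -> measurable X ->
  mu X = (`|a|%:E * mu ((fun x : R => (a * x + b)%R) @^-1` X))%E.
Proof.
move=> a0 mX.
pose f : measurableTypeR R -> measurableTypeR R := fun x : R => a * x + b.
have mf : measurable_fun setT f by exact: affine_measurable.
pose m' := mscale (NngNum (normr_ge0 a)) (pushforward mu f).
apply: (@lebesgue_measure_unique R (m' mf) _ X mX) => _ [[x y] xy <-].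
transitivity (`|a|%:E * mu (f @^-1` `]x, y]%classic))%E; last by [].
have [a_gt0|a_le0] := ltP 0 a.
  have -> : f @^-1` `]x, y] = `](x - b) / a, (y - b) / a]%classic.
    apply/seteqP; split => z; rewrite /= !in_itv /= /f;
      rewrite ltr_pdivrMr// ler_pdivlMr// ltrBlDr lerBrDr mulrC //.
  rewrite !lebesgue_measure_itv /= !lte_fin ltr_pM2r ?invr_gt0// ltrD2r.
  case: ifP => _; last by rewrite mule0.
  rewrite -!EFinB -EFinM gtr0_norm//; congr EFin; by field.
have a_lt0 : a < 0 by rewrite lt_neqAle a0.
have -> : f @^-1` `]x, y] = `[(y - b) / a, (x - b) / a[%classic.
  apply/seteqP; split => z; rewrite /= !in_itv /= /f;
    rewrite ltr_ndivlMr// ler_ndivrMr// ltrBlDr lerBrDr mulrC andbC //.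
rewrite !lebesgue_measure_itv /= !lte_fin ltr_nM2r ?invr_lt0// ltrD2r.
case: ifP => _; last by rewrite mule0.
rewrite -!EFinB -EFinM ltr0_norm//; congr EFin; by field.
Qed.

Lemma integral_affine (a b : R) (g : R -> \bar R) : a != 0 ->
  measurable_fun [set: measurableTypeR R] (g : measurableTypeR R -> \bar R) ->
  (forall t : R, 0 <= g t)%E ->
  (\int[mu]_t g t = `|a|%:E * \int[mu]_t g (a * t + b)%R)%E.
Proof.
move=> a0 mg g0.
pose f : measurableTypeR R -> measurableTypeR R := fun x : R => a * x + b.
have mf : measurable_fun setT f by exact: affine_measurable.
pose m' := mscale (NngNum (normr_ge0 a)) (pushforward mu f).
transitivity (\int[m' mf]_t g t)%E.
  by apply: eq_measure_integral => /= A mA _; exact: lebesgue_affine.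
by rewrite ge0_integral_mscale//= ge0_integral_pushforward.
Qed.

(** The product sigma-algebra is generated by rectangles, so an open set has to be
    exhausted by countably many of them: the boxes with rational centre and radius
    1 / (m + 1) that it contains. *)
Lemma open_plane_measurable (U : set (plane R)) : open U ->
  measurable (U : set mplane).
Proof.
move=> oU.
pose box (q : rat * rat * nat) : set (plane R) :=
  ball (ratr q.1.1 : R^o) q.2.+1%:R^-1 `*` ball (ratr q.1.2 : R^o) q.2.+1%:R^-1.
have -> : U = \bigcup_(q in [set q | box q `<=` U]) box q.
  apply/seteqP; split => [x Ux|x [q /= + bx]]; last exact.
  have /nbhs_ballP[r /= r0 rU] : nbhs x U by exact: open_nbhs_nbhs.
  have [n n_r] : exists n, n.+1%:R^-1 < r / 2 :> R.
    exists (Num.truncn (r / 2)^-1).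
    rewrite invf_plt ?posrE ?divr_gt0//; exact: truncnS_gt.
  have n0 : 0 < n.+1%:R^-1 :> R by rewrite invr_gt0.
  have rat_near (t : R) : exists q : rat, `|t - ratr q| < n.+1%:R^-1.
    move: n0; set e := n.+1%:R^-1 => e0.
    have [|q] := @rat_in_itvoo R (t - e) (t + e); first lra.
    rewrite in_itv /= => /andP[q1 q2]; exists q.
    by rewrite ltr_norml; apply/andP; split; lra.
  have [[q1 xq1] [q2 xq2]] := (rat_near x.1, rat_near x.2).
  exists (q1, q2, n); last by split; rewrite /= -ball_normE /= distrC.
  move=> y [/=]; rewrite -!ball_normE /= => y1 y2; apply: rU.
  split; rewrite -ball_normE /=.
    apply: (le_lt_trans (ler_distD (ratr q1) _ _)).
    rewrite [r]splitr ltrD ?(lt_trans _ n_r)//.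
  apply: (le_lt_trans (ler_distD (ratr q2) _ _)).
  by rewrite [r]splitr ltrD ?(lt_trans _ n_r)//.
rewrite bigcup_mkcond; apply: countable_bigcupT_measurable => // q.
case: ifPn => // _; apply: measurableX; apply: open_measurable; exact: ball_open.
Qed.

Lemma compact_plane_measurable A : compact A -> measurable (A : set mplane).
Proof.
move=> /compact_closed cA; rewrite -(setCK A); apply: measurableC.
apply: open_plane_measurable; apply: closed_openC; apply: cA.
exact: norm_hausdorff.
Qed.

Lemma compact_plane_finite A : compact A -> (mu2 A < +oo)%E.
Proof.
move=> cA; have /ex_strict_bound_gt0[M M0 /= AM] := compact_bounded cA.
pose I : set R := `[- M, M]%classic.
have mI : measurable I by exact: measurable_itv.
apply: (@le_lt_trans _ _ (mu2 (I `*` I))).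
  apply: le_measure; rewrite ?inE; [exact: compact_plane_measurable|
    exact: measurableX|].
  move=> x /AM; rewrite prod_normE gt_max => /andP[].
  rewrite !ltr_norml => /andP[? ?] /andP[? ?].
  by split; rewrite /I /= in_itv /=; apply/andP; split; apply: ltW.
rewrite product_measure1E//.
rewrite -[X in (X < _)%E]/(mu I * mu I)%E /I.
rewrite lebesgue_measure_itv /=; case: ifP => _; last by rewrite mule0.
by rewrite -!EFinB -EFinM ltry.
Qed.

Lemma swap_mu2 (A : set (plane R)) : measurable (A : set mplane) ->
  mu2 A = mu2 (@swap_pair R R @^-1` A).
Proof.
move=> mA.
have ms : measurable_fun setT
    (@swap_pair (measurableTypeR R) (measurableTypeR R) : mplane -> mplane).
  exact: measurable_fun_pair.
pose nu : {measure set mplane -> \bar R} := mu2.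
pose f : mplane -> mplane := @swap_pair (measurableTypeR R) (measurableTypeR R).
pose m' := (pushforward nu f : {measure set mplane -> \bar R}).
have mE : forall X Y, measurable X -> measurable Y ->
    m' ms (X `*` Y) = (mu X * mu Y)%E.
  move=> X Y mX mY.
  rewrite [LHS](_ : _ = mu2 (Y `*` X)); last first.
    by congr mu2; apply/seteqP; split => -[x y] [].
  by rewrite product_measure1E// muleC.
have := @product_measure_unique _ _ _ _ R mu mu (m' ms) mE A mA.
exact.
Qed.

(** The product measure integrates the lengths of vertical sections, and a map that
    sends vertical lines to vertical lines acts on every section, and on the set of
    sections, by an affine map of the line. *)
Lemma affine_mu2 (a1 b1 a2 b2 c : R) A : a1 != 0 -> a2 != 0 ->
  measurable (A : set mplane) ->
  mu2 A = ((`|a1| * `|a2|)%:E *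
    mu2 ((fun x => (a1 * x.1 + b1, a2 * x.2 + (b2 + c * x.1))%R) @^-1` A))%E.
Proof.
move=> a10 a20 mA.
pose f : mplane -> mplane :=
  fun x => (a1 * x.1 + b1, a2 * x.2 + (b2 + c * x.1))%R.
have mf : measurable_fun setT f.
  apply: measurable_fun_pair => /=.
    by apply: measurable_funD => //; apply: measurable_funM.
  apply: measurable_funD; first by apply: measurable_funM.
  by apply: measurable_funD => //; apply: measurable_funM.
have mfA : measurable (f @^-1` A) by rewrite -[X in measurable X]setTI; exact: mf.
rewrite {1}/product_measure1 (@integral_affine a1 b1)//; last first.
  exact: measurable_fun_xsection.
rewrite EFinM -muleA; congr (_ * _)%E.
rewrite /product_measure1 -ge0_integralZl//; last first.
  exact: measurable_fun_xsection.
apply: eq_integral => t _ /=.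
rewrite (@lebesgue_affine a2 (b2 + c * t))//; last exact: measurable_xsection.
Qed.

End PlaneMeasure.

(** * Area under linear maps *)

Section AreaLinear.
Context {R : realType}.
Implicit Types (A B : set (plane R)).

Local Notation mu := (@lebesgue_measure R).
Local Notation mu2 := (mu \x mu)%E.
Local Notation mplane := (measurableTypeR R * measurableTypeR R)%type.

Definition linmap (a b c d : R) : plane R -> plane R :=
  fun x => (a * x.1 + b * x.2, c * x.1 + d * x.2).

Lemma linform_continuous (a b : R) : 
  continuous (fun x : plane R => a * x.1 + b * x.2 : R).
Proof.
move=> x; apply: cvgD; apply: cvgMr; [exact: cvg_fst|exact: cvg_snd].
Qed.

Lemma linmap_continuous a b c d : continuous (linmap a b c d).
Proof.
move=> x U [[U1 U2] [/= n1 n2] sU].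
have h1 : \forall y \near x, U1 (a * y.1 + b * y.2) := linform_continuous n1.
have h2 : \forall y \near x, U2 (c * y.1 + d * y.2) := linform_continuous n2.
by apply: filterS2 h1 h2 => y y1 y2; exact: sU.
Qed.

Lemma image_compact (f : plane R -> plane R) A :
  continuous f -> compact A -> compact (f @` A).
Proof.
by move=> cf cA; apply: continuous_compact => //; apply: continuous_subspaceT.
Qed.

Lemma preimage_imageK (f : plane R -> plane R) A :
  injective f -> f @^-1` (f @` A) = A.
Proof.
move=> f_inj; apply/seteqP; split => [x [y Ay /f_inj <-]//|x Ax].
by exists x.
Qed.

Lemma area_ge0 A : 0 <= area A.
Proof. by apply: fine_ge0; apply: integral_ge0. Qed.

Lemma area_le A B : compact A -> compact B -> A `<=` B -> area A <= area B.
Proof.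
move=> cA cB AB; apply: fine_le; rewrite ?ge0_fin_numE ?integral_ge0//.
- exact: compact_plane_finite.
- exact: compact_plane_finite.
- by apply: le_measure; rewrite ?inE//; exact: compact_plane_measurable.
Qed.

Lemma area_setU A B : compact A -> compact B ->
  area (A `|` B) + area (A `&` B) = area A + area B.
Proof.
move=> cA cB.
have [mA mB] := (compact_plane_measurable cA, compact_plane_measurable cB).
have fin C : compact C -> mu2 C \is a fin_num.
  by move=> cC; rewrite ge0_fin_numE ?integral_ge0//; exact: compact_plane_finite.
have finI : mu2 (A `&` B) \is a fin_num.
  by apply: fin; apply: compact_closedI => //; apply: compact_closed.
have E : (mu2 (A `|` B) = mu2 A + mu2 B - mu2 (A `&` B))%E :=
  measureUfinl mA mB (compact_plane_finite cA).
rewrite /area E; move: (fin _ cA) (fin _ cB) finI.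
case: (mu2 A) => [a||]//; case: (mu2 B) => [b||]//.
by case: (mu2 (A `&` B)) => [c||]// _ _ _ /=; rewrite subrK.
Qed.

Lemma area_linmap_lower (a c d : R) A : a != 0 -> d != 0 -> compact A ->
  area (linmap a 0 c d @` A) = `|a * d| * area A.
Proof.
move=> a0 d0 cA; rewrite /area.
have cI : compact (linmap a 0 c d @` A).
  by apply: image_compact => //; exact: linmap_continuous.
rewrite (affine_mu2 0 0 c a0 d0 (compact_plane_measurable cI)).
have -> : (fun x : plane R => (a * x.1 + 0, d * x.2 + (0 + c * x.1))) =
    linmap a 0 c d.
  by apply/funext => x; rewrite /linmap mul0r add0r addrC; congr pair; ring.
rewrite preimage_imageK; last first.
  move=> [x1 x2] [y1 y2] [] /=; rewrite !mul0r !addr0 => /(mulfI a0) ->.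
  by move=> /addrI/(mulfI d0) ->.
have k0 : 0 < `|a * d| by rewrite normr_gt0 mulf_neq0.
rewrite -normrM; move: k0; move: `|a * d| => k k0.
case: (mu2 A) => [r||] //=; first by rewrite gt0_muley ?lte_fin// mulr0.
by rewrite gt0_muleNy ?lte_fin// mulr0.
Qed.

Lemma area_swap A : compact A -> area (linmap 0 1 1 0 @` A) = area A.
Proof.
move=> cA; rewrite /area [in RHS]swap_mu2; last exact: compact_plane_measurable.
congr (fine (mu2 _)); apply/seteqP; split => [_ [x Ax <-]|x /= Ax].
  by rewrite /swap_pair /linmap /= !mul0r !mul1r add0r addr0 -surjective_pairing.
exists (swap_pair x) => //; case: x Ax => x1 x2 _.
by rewrite /linmap /= !mul0r !mul1r add0r addr0.
Qed.

Lemma linmap_comp a b c d a' b' c' d' A :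
  linmap a b c d @` (linmap a' b' c' d' @` A) =
  linmap (a * a' + b * c') (a * b' + b * d')
         (c * a' + d * c') (c * b' + d * d') @` A.
Proof.
rewrite image_comp; congr image; apply/funext => x.
by rewrite /linmap /=; congr pair; ring.
Qed.

(** A matrix whose upper left entry is not zero is a product of lower triangular
    matrices and of exchanges of the coordinates; exchanging the columns reduces the
    other matrices to these. *)
Lemma area_linmap (a b c d : R) A : a * d - b * c != 0 -> compact A ->
  area (linmap a b c d @` A) = `|a * d - b * c| * area A.
Proof.
have a_case (a' b' c' d' : R) B : a' != 0 -> a' * d' - b' * c' != 0 ->
    compact B ->
    area (linmap a' b' c' d' @` B) = `|a' * d' - b' * c'| * area B.
  move=> a0 D0 cB.
  have cI (p q r s : R) (M : set (plane R)) :
      compact M -> compact (linmap p q r s @` M).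
    by apply: image_compact; exact: linmap_continuous.
  (* L U factorisation, the upper triangular factor being a lower triangular one
     conjugated by the exchange of coordinates. *)
  have -> : linmap a' b' c' d' @` B = linmap a' 0 c' 1 @` (linmap 0 1 1 0 @`
    (linmap ((a' * d' - b' * c') / a') 0 (b' / a') 1 @` (linmap 0 1 1 0 @` B))).
    by rewrite !linmap_comp; congr (linmap _ _ _ _ @` _); field.
  rewrite area_linmap_lower ?oner_neq0//; last exact/cI/cI/cI.
  rewrite area_swap; last exact/cI/cI.
  rewrite area_linmap_lower ?oner_neq0 ?mulf_neq0 ?invr_eq0//; last exact/cI.
  by rewrite area_swap// !mulr1 mulrA -normrM mulrCA divff// mulr1.
move=> D0 cA; have [a0|] := eqVneq a 0; last by move=> a0; exact: a_case.
have b0 : b != 0 by apply: contra_neq D0 => ->; rewrite a0; ring.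
have -> : linmap a b c d @` A = linmap b a d c @` (linmap 0 1 1 0 @` A).
  by rewrite linmap_comp; congr (linmap _ _ _ _ @` _); ring.
rewrite a_case ?area_swap//; last 2 first.
- by rewrite -oppr_eq0 opprB.
- by apply: image_compact => //; exact: linmap_continuous.
by rewrite -normrN; congr (`|_| * _); ring.
Qed.

Lemma area_translate v A : compact A -> area (translate v A) = area A.
Proof.
move=> cA.
have cT : compact (translate v A).
  apply: image_compact => // x; apply: cvgD; [exact: cvg_cst|exact: cvg_id].
have mT := compact_plane_measurable cT.
rewrite /area (@affine_mu2 R 1 v.1 1 v.2 0 _ _ _ mT) ?oner_neq0//.
rewrite !normr1 mulr1 mul1e; congr (fine (mu2 _)).
have -> : (fun x : plane R => (1 * x.1 + v.1, 1 * x.2 + (v.2 + 0 * x.1))) =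
    (fun x => v + x).
  by apply/funext => x; plane_ring.
by apply: preimage_imageK; exact: addrI.
Qed.

Lemma area_dilate (k : R) A : k != 0 -> compact A ->
  area (dilate k A) = k ^+ 2 * area A.
Proof.
move=> k0 cA.
have -> : dilate k A = linmap k 0 0 k @` A.
  congr image; apply/funext => x; rewrite /linmap !mul0r addr0 add0r.
  by case: x.
rewrite area_linmap ?mulr0 ?subr0 ?mulf_neq0// -expr2 ger0_norm//.
exact: sqr_ge0.
Qed.

End AreaLinear.

(** * Adding a segment to a convex body *)

Section SegmentSum.
Context {R : realType}.
Implicit Types (A B K Q M P : set (plane R)) (x y z p q u v e : plane R).

Local Notation mu := (@lebesgue_measure R).
Local Notation mu2 := (mu \x mu)%E.
Local Notation mplane := (measurableTypeR R * measurableTypeR R)%type.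

Lemma det2_continuous w : continuous (fun x => det2 w x : R).
Proof.
have -> : (fun x => det2 w x) = (fun y : plane R => - w.2 * y.1 + w.1 * y.2).
  by apply/funext => y; rewrite /det2; ring.
exact: linform_continuous.
Qed.

Lemma det2_max M w : compact M -> M !=set0 ->
  exists2 k, M k & forall x, M x -> det2 w x <= det2 w k.
Proof.
move=> cM M0.
have [|k /set_mem Mk kmax] := @compact_EVT_max _ R (fun x => det2 w x) M M0 cM.
  by apply: continuous_subspaceT; exact: det2_continuous.
by exists k => // x Mx; apply: kmax; exact: mem_set.
Qed.

Lemma det2_min M w : compact M -> M !=set0 ->
  exists2 k, M k & forall x, M x -> det2 w k <= det2 w x.
Proof.
move=> cM M0; have [k Mk kmax] := det2_max (- w) cM M0.
by exists k => // x /kmax; rewrite !det2Nl lerN2.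
Qed.

Lemma msum_compact A B : compact A -> compact B -> compact (msum A B).
Proof.
move=> cA cB.
have -> : msum A B = (fun z : plane R * plane R => z.1 + z.2) @` (A `*` B).
  apply/seteqP; split => [_ [x Ax [y By <-]]|_ [[x y] [/= Ax By] <-]].
    by exists (x, y).
  by exists x => //; exists y.
apply: continuous_compact; last exact: compact_setX.
apply: continuous_subspaceT => z; apply: cvgD; [exact: cvg_fst|exact: cvg_snd].
Qed.

Lemma msum_convex A B : convex_set A -> convex_set B -> convex_set (msum A B).
Proof.
move=> /convexP cA /convexP cB; apply/convexP.
move=> _ _ t t01 [x Ax [y By <-]] [x' Ax' [y' By' <-]].
exists ((1 - t) *: x + t *: x'); first exact: cA.
exists ((1 - t) *: y + t *: y'); first exact: cB.
by rewrite !scalerDr addrACA.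
Qed.

Lemma linmap_convex a b c d A : convex_set A -> convex_set (linmap a b c d @` A).
Proof.
move=> /convexP cA; apply/convexP => _ _ t t01 [x Ax <-] [y Ay <-].
exists ((1 - t) *: x + t *: y); first exact: cA.
by plane_ring.
Qed.

Lemma segment0P e x : segment 0 e x <-> exists2 t : R, 0 <= t <= 1 & x = t *: e.
Proof.
by split => -[t t01 ->]; exists t => //; rewrite scaler0 add0r.
Qed.

Lemma segmentxx p : segment p p = [set p].
Proof.
apply/seteqP; split => [_ [t _ ->]|_ ->].
  by rewrite -scalerDl subrK scale1r.
by exists 0; rewrite ?lexx ?ler01// subr0 scale1r scale0r addr0.
Qed.

Lemma segment_convex p q : convex_set (segment p q).
Proof.
apply/convexP => _ _ t /andP[t0 t1] [s /andP[s0 s1] ->] [r /andP[r0 r1] ->].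
exists ((1 - t) * s + t * r).
  by apply/andP; split; nra.
by plane_ring.
Qed.

Lemma plane_segment_compact p q : compact (segment p q).
Proof.
have -> : segment p q = (fun t : R => (1 - t) *: p + t *: q) @` `[0, 1]%classic.
  apply/seteqP; split => [_ [t t01 ->]|_ [t t01 <-]].
    by exists t => //=; rewrite in_itv.
  by exists t => //; move: t01; rewrite /= in_itv.
apply: continuous_compact; last exact: segment_compact.
apply: continuous_subspaceT => t; apply: cvgD; apply: cvgZr_tmp.
  by apply: cvgB; [exact: cvg_cst|exact: cvg_id].
exact: cvg_id.
Qed.

Lemma xsection_convex_compact M (t : R) : compact M -> convex_set M ->
  (exists2 x, M x & x.1 = t) ->
  exists a b : R, a <= b /\ forall y : R, M (t, y) <-> a <= y <= b.
Proof.
move=> cM /convexP vM [x Mx xt].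
pose Mt := M `&` [set y | y.1 = t].
have cMt : compact Mt.
  apply: compact_closedI => //.
  have -> : [set y : plane R | y.1 = t] = fst @^-1` [set t] by [].
  by apply: closed_comp => [y _|]; [exact: cvg_fst|exact: closed_eq].
have Mt0 : Mt !=set0 by exists x.
have [a [Ma /= a1] amin] := det2_min (1, 0) cMt Mt0.
have [b [Mb /= b1] bmax] := det2_max (1, 0) cMt Mt0.
have dE (y : plane R) : det2 (1, 0) y = y.2 by rewrite /det2 /= mul1r mul0r subr0.
exists a.2, b.2; split; first by rewrite -!dE; apply: bmax.
move=> y; split => [My|/andP[ay yb]].
  have Mty : Mt (t, y) by [].
  by have := amin _ Mty; have := bmax _ Mty; rewrite !dE /= => -> ->.
have [ab|ab] := eqVneq a.2 b.2.
  have -> : y = a.2 by apply/eqP; rewrite eq_le ay ab yb.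
  by rewrite -a1 -surjective_pairing.
have ab0 : 0 < b.2 - a.2 by rewrite subr_gt0 lt_neqAle ab (le_trans ay).
have := vM a b ((y - a.2) / (b.2 - a.2)) _ Ma Mb.
rewrite divr_ge0 ?subr_ge0 ?(le_trans ay)//= ler_pdivrMr// mul1r lerD2r => /(_ yb).
congr M; apply: injective_projections; rewrite /= /GRing.scale /= ?a1 ?b1.
  by ring.
by field; rewrite gt_eqF.
Qed.

Lemma mu_itv (a b : R) : a <= b -> mu `[a, b]%classic = (b - a)%:E.
Proof.
move=> ab; rewrite lebesgue_measure_itv /= lte_fin.
by case: ltP => // ba; rewrite (@le_anti _ _ a b) ?ab// subrr.
Qed.

(** Every nonempty vertical section of [M] is an interval, and adding the vertical
    unit segment makes it longer by 1; the area grows by the length of the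
    projection of [M]. *)
Lemma vertical_segment_area M x y : compact M -> convex_set M ->
  M x -> M y -> (forall z, M z -> x.1 <= z.1 <= y.1) ->
  area (msum M (segment 0 (0, 1))) = area M + (y.1 - x.1).
Proof.
move=> cM vM Mx My xy.
have xy1 : x.1 <= y.1 by have /andP[] := xy _ My.
pose S : set (plane R) := segment 0 (0, 1).
have cS : compact S by exact: plane_segment_compact.
have cMS : compact (msum M S) by exact: msum_compact.
have fiberE (t : R) : mu (xsection (msum M S) t) =
    (mu (xsection M t) + (\1_(`[x.1, y.1]%classic : set R) t)%:E)%E.
  rewrite indicE.
  have [/set_mem /= tI|/negP/(_ (mem_set _)) /= tI] :=
    boolP (t \in (`[x.1, y.1]%classic : set R)); last first.
    have -> : xsection (msum M S) t = set0.
      apply/seteqP; split => // z; rewrite xsectionE /=.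
      move=> [u Mu [v /segment0P[s _ ->]]] [tE _]; apply: tI.
      by rewrite in_itv /= -tE scaler0 addr0; exact: xy.
    have -> : xsection M t = set0.
      apply/seteqP; split => // z; rewrite xsectionE /= => Mz; apply: tI.
      by rewrite in_itv; exact: (xy _ Mz).
    by rewrite measure0 adde0.
  have [a [b [ab abP]]] : exists a b : R, a <= b /\
      forall z : R, M (t, z) <-> a <= z <= b.
    apply: xsection_convex_compact => //.
    move: tI; rewrite in_itv /= => /andP[xt ty].
    have [xye|xye] := eqVneq x.1 y.1.
      by exists x => //; apply/eqP; rewrite eq_le xt xye ty.
    have d0 : 0 < y.1 - x.1 by rewrite subr_gt0 lt_neqAle xye.
    exists ((1 - (t - x.1) / (y.1 - x.1)) *: x + ((t - x.1) / (y.1 - x.1)) *: y).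
      move/convexP : vM; apply=> //.
      by rewrite divr_ge0 ?subr_ge0//= ler_pdivrMr// mul1r lerD2r.
    by rewrite /= /GRing.scale /=; field; rewrite gt_eqF.
  have -> : xsection M t = `[a, b]%classic.
    by apply/seteqP; split => z; rewrite xsectionE /= in_itv /= => /abP.
  have -> : xsection (msum M S) t = `[a, b + 1]%classic.
    apply/seteqP; split => z; rewrite xsectionE /= in_itv /=.
      move=> [u Mu [v /segment0P[s /andP[s0 s1] ->]]] [tE <-].
      have /abP : M (t, u.2).
        by rewrite -tE scaler0 addr0 -surjective_pairing.
      by rewrite /GRing.scale /= => /andP[? ?]; apply/andP; split; lra.
    move=> /andP[az zb]; have [zb'|bz] := leP z b.
      exists (t, z); first by apply/abP; rewrite az zb'.
      exists 0; first by apply/segment0P; exists 0; rewrite ?lexx ?ler01 ?scale0r.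
      by rewrite addr0.
    exists (t, b); first by apply/abP; rewrite ab lexx.
    exists (0, z - b).
      apply/segment0P; exists (z - b); first by apply/andP; split; lra.
      by apply: injective_projections; rewrite /= /GRing.scale /= ?mulr0 ?mulr1.
    by plane_ring.
  rewrite !mu_itv//; last lra.
  by rewrite -EFinD; congr EFin; ring.
have finM : mu2 M \is a fin_num.
  by rewrite ge0_fin_numE ?integral_ge0//; exact: compact_plane_finite.
have E : mu2 (msum M S) = (mu2 M + (y.1 - x.1)%:E)%E.
  rewrite {1}/product_measure1.
  under eq_integral do rewrite /= fiberE.
  rewrite ge0_integralD//=; last 2 first.
  - by apply: measurable_fun_xsection => //; exact: compact_plane_measurable.
  - by apply/measurable_EFinP; exact: measurable_indic.
  by rewrite integral_indic//= setIT mu_itv.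
by rewrite /area E fineD.
Qed.

Lemma linmap_msum a b c d A B :
  linmap a b c d @` msum A B = msum (linmap a b c d @` A) (linmap a b c d @` B).
Proof.
apply/seteqP; split.
  move=> _ [_ [x Ax [y By <-]] <-]; exists (linmap a b c d x); first by exists x.
  exists (linmap a b c d y); first by exists y.
  by plane_ring.
move=> _ [_ [x Ax <-] [_ [y By <-] <-]]; exists (x + y).
  by exists x => //; exists y.
by plane_ring.
Qed.

Lemma linmap_segment a b c d p q :
  linmap a b c d @` segment p q = segment (linmap a b c d p) (linmap a b c d q).
Proof.
have E (t : R) : linmap a b c d ((1 - t) *: p + t *: q) =
    (1 - t) *: linmap a b c d p + t *: linmap a b c d q.
  by plane_ring.
apply/seteqP; split => [_ [_ [t t01 ->] <-]|_ [t t01 ->]].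
  by exists t.
by rewrite -E; exists ((1 - t) *: p + t *: q) => //; exists t.
Qed.

(** Cavalieri: the area grows by the length of [e] times the width of [M] across
    [e].  A linear map of determinant 1 that sends [e] to the vertical unit vector
    reduces this to [vertical_segment_area]. *)
Lemma area_msum_segment M e x y : compact M -> convex_set M ->
  M x -> M y -> (forall z, M z -> det2 e x <= det2 e z <= det2 e y) ->
  area (msum M (segment 0 e)) = area M + (det2 e y - det2 e x).
Proof.
move=> cM vM Mx My xy.
have [->|e0] := eqVneq e 0.
  have -> : msum M (segment 0 0) = M.
    apply/seteqP; split => [_ [z Mz [_ [t _ ->] <-]]|z Mz].
      by rewrite !scaler0 !addr0.
    exists z => //; exists 0; last by rewrite addr0.
    by exists 0; rewrite ?lexx ?ler01 ?scaler0 ?addr0.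
  by rewrite /det2 /= !mul0r !subrr addr0.
have N0 := sqr_norm_gt0 (elimN eqP e0).
set N := e.1 ^+ 2 + e.2 ^+ 2 in N0.
(* The rows are [- det2 e] and the orthogonal projection to the line of [e]. *)
pose T := linmap e.2 (- e.1) (e.1 / N) (e.2 / N).
have D1 : e.2 * (e.2 / N) - - e.1 * (e.1 / N) = 1.
  have -> : e.2 * (e.2 / N) - - e.1 * (e.1 / N) = N / N by rewrite /N; ring.
  by rewrite divff// gt_eqF.
have T1 z : (T z).1 = - det2 e z by rewrite /T /det2 /=; ring.
have Te : T e = (0, 1).
  apply: injective_projections => /=; first by ring.
  by rewrite -[RHS]D1; ring.
have areaT A : compact A -> area (T @` A) = area A.
  by move=> cA; rewrite area_linmap ?D1 ?oner_neq0// normr1 mul1r.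
have cS := @plane_segment_compact 0 e.
rewrite -areaT; last exact: msum_compact.
rewrite linmap_msum linmap_segment -!/T Te.
have -> : T 0 = 0 by plane_ring.
rewrite (@vertical_segment_area _ (T y) (T x)).
- by rewrite areaT// !T1; ring.
- by apply: image_compact => //; exact: linmap_continuous.
- exact: linmap_convex.
- by exists y.
- by exists x.
- move=> _ [z Mz <-]; rewrite !T1 !lerN2 andbC; exact: xy.
Qed.

End SegmentSum.

(** * The excess of a Minkowski sum *)

Section Excess.
Context {R : realType}.
Implicit Types (A B K Q M P : set (plane R)) (x y z p q u v e : plane R).

Lemma halfplane_closed e (c : R) :
  [/\ closed [set x | det2 e x <= c], closed [set x | c <= det2 e x] &
      closed [set x | det2 e x = c]].
Proof.
have cont := @det2_continuous R e; split.
- by apply: (@closed_comp _ _ (fun x => det2 e x) [set t | t <= c]) => [x _|];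
    [exact: cont|exact: closed_le].
- by apply: (@closed_comp _ _ (fun x => det2 e x) [set t | c <= t]) => [x _|];
    [exact: cont|exact: closed_ge].
- by apply: (@closed_comp _ _ (fun x => det2 e x) [set t | t = c]) => [x _|];
    [exact: cont|exact: closed_eq].
Qed.

(** Adding a convex [K] commutes with the union and the intersection of the two
    parts into which a line cuts [Q].  Only the intersection needs an
    argument: if q + k = q' + k' with [q] and [q'] on different sides, then a convex
    combination of [q] and [q'] lies on the line, and the same combination of [k]
    and [k'] lies in [K]. *)
Lemma area_msum_cut Q K e (c : R) :
  compact Q -> convex_set Q -> compact K -> convex_set K ->
  area (msum (Q `&` [set x | det2 e x <= c]) K) +
    area (msum (Q `&` [set x | c <= det2 e x]) K) =
  area (msum Q K) + area (msum (Q `&` [set x | det2 e x = c]) K).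
Proof.
move=> cQ /convexP vQ cK /convexP vK.
have [cl1 cl2 cl3] := halfplane_closed e c.
have c1 := msum_compact (compact_closedI cQ cl1) cK.
have c2 := msum_compact (compact_closedI cQ cl2) cK.
rewrite -area_setU//; congr (area _ + area _).
  apply/seteqP; split => [x [] [q [Qq _] [k Kk <-]]|_ [q Qq [k Kk <-]]].
  - by exists q => //; exists k.
  - by exists q => //; exists k.
  have [qc|/ltW qc] := leP (det2 e q) c.
    by left; exists q => //; exists k.
  by right; exists q => //; exists k.
apply/seteqP; split => [z [[q [Qq /= qc] [k Kk kz]]]|_ [q [Qq /= qc] [k Kk <-]]].
  move=> [q' [Qq' /= qc'] [k' Kk' kz']].
  have [t t01 ct] : exists2 t : R, 0 <= t <= 1 &
      (1 - t) * det2 e q + t * det2 e q' = c.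
    have [qe|qe] := eqVneq (det2 e q) (det2 e q').
      exists 0; first by rewrite lexx ler01.
      have -> : c = det2 e q by apply/eqP; rewrite eq_le qc andbT qe.
      by ring.
    have d0 : 0 < det2 e q' - det2 e q.
      by rewrite subr_gt0 lt_neqAle qe (le_trans qc).
    exists ((c - det2 e q) / (det2 e q' - det2 e q)).
      by rewrite divr_ge0 ?subr_ge0 ?(le_trans qc)//= ler_pdivrMr// mul1r lerD2r.
    by field; rewrite gt_eqF.
  exists ((1 - t) *: q + t *: q').
    by split; [exact: vQ|rewrite /= det2Dr !det2Zr].
  exists ((1 - t) *: k + t *: k'); first exact: vK.
  have -> : z = (1 - t) *: (q + k) + t *: (q' + k').
    by rewrite kz kz' -scalerDl subrK scale1r.
  by rewrite !scalerDr addrACA.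
split; (exists q; last by exists k); split => //=; by rewrite qc.
Qed.

(** This admits the body [set 0], for which statements about area (Q + K) become
    statements about area Q. *)
Definition sym_body K :=
  [/\ compact K, convex_set K, o_symmetric K & K !=set0].

(** The support function of [K] turned by a right angle: for a symmetric [K], |e|
    times half of the width of [K] orthogonally to [e].  The perimeter of a polygon
    measured by [hwidth K] is twice its mixed area with [K]. *)
Definition hwidth K e : R := sup [set det2 e x | x in K].

Lemma o_symmetricN K x : o_symmetric K -> K x -> K (- x).
Proof. by move=> KN Kx; rewrite KN; exists x. Qed.

Lemma hwidth_eq K e (r : R) : (forall x, K x -> det2 e x <= r) ->
  (exists2 k, K k & det2 e k = r) -> hwidth K e = r.
Proof.
move=> Kr [k Kk kr]; apply/eqP; rewrite eq_le; apply/andP; split.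
  by apply: ge_sup => [|_ [x /Kr xr <-]//]; exists r; exists k.
by apply: ub_le_sup; [exists r => _ [x /Kr xr <-]|exists k].
Qed.

Section SymBody.
Variable K : set (plane R).
Hypothesis bK : sym_body K.

Lemma hwidth_max e : exists2 k, K k & det2 e k = hwidth K e.
Proof.
have [cK _ _ K0] := bK; have [k Kk kmax] := det2_max e cK K0.
by exists k => //; apply/esym/hwidth_eq => //; exists k.
Qed.

Lemma hwidth_ge e x : K x -> det2 e x <= hwidth K e.
Proof.
have [cK _ _ K0] := bK; have [k Kk kmax] := det2_max e cK K0.
by move=> Kx; rewrite (hwidth_eq kmax) ?kmax//; exists k.
Qed.

Lemma hwidth_le e x : K x -> - hwidth K e <= det2 e x.
Proof.
have [_ _ KN _] := bK => /(o_symmetricN KN)/(hwidth_ge e).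
by rewrite det2Nr lerNl.
Qed.

Lemma hwidth_min e : exists2 k, K k & det2 e k = - hwidth K e.
Proof.
have [_ _ KN _] := bK; have [k Kk ke] := hwidth_max e.
by exists (- k); [exact: o_symmetricN|rewrite det2Nr ke].
Qed.

Lemma hwidthZ (t : R) e : 0 <= t -> hwidth K (t *: e) = t * hwidth K e.
Proof.
move=> t0; apply: hwidth_eq => [x Kx|].
  by rewrite det2Zl ler_wpM2l// hwidth_ge.
by have [k Kk ke] := hwidth_max e; exists k => //; rewrite det2Zl ke.
Qed.

Lemma hwidthN e : hwidth K (- e) = hwidth K e.
Proof.
apply: hwidth_eq => [x Kx|]; first by rewrite det2Nl lerNl hwidth_le.
by have [k Kk ke] := hwidth_min e; exists k; rewrite // det2Nl ke opprK.
Qed.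

Lemma hwidth_ge0 e : 0 <= hwidth K e.
Proof.
have [_ _ _ [x Kx]] := bK; have := hwidth_ge e Kx; have := hwidth_le e Kx.
by lra.
Qed.

Lemma hwidth_dilate (t : R) e : 0 <= t -> hwidth (dilate t K) e = t * hwidth K e.
Proof.
move=> t0; apply: hwidth_eq => [_ [x Kx <-]|].
  by rewrite det2Zr ler_wpM2l// hwidth_ge.
have [k Kk ke] := hwidth_max e; exists (t *: k); first by exists k.
by rewrite det2Zr ke.
Qed.

(** This is area Q + 2 A(Q, K).  Like area (Q + K) it is additive for cuts by a line,
    but it vanishes on points. *)
Definition excess Q : R := area (msum Q K) - area K.

Lemma excess_translate v Q : compact Q -> excess (translate v Q) = excess Q.
Proof.
have [cK _ _ _] := bK => cQ; rewrite /excess -(area_translate v (msum_compact cQ cK)).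
congr (area _ - _); apply/seteqP; split.
  move=> _ [_ [q Qq <-] [k Kk <-]]; exists (q + k); last by rewrite addrA.
  by exists q => //; exists k.
move=> _ [_ [q Qq [k Kk <-]] <-]; exists (v + q); first by exists q.
by exists k => //; rewrite addrA.
Qed.

Lemma excess_opp Q : compact Q -> excess (dilate (- 1) Q) = excess Q.
Proof.
have [cK _ KN _] := bK => cQ; rewrite /excess.
have -> : msum (dilate (- 1) Q) K = dilate (- 1) (msum Q K).
  apply/seteqP; split.
    move=> _ [_ [q Qq <-] [k Kk <-]]; exists (q - k).
      by exists q => //; exists (- k) => //; exact: o_symmetricN.
    by rewrite !scaleN1r opprB addrC.
  move=> _ [_ [q Qq [k Kk <-]] <-]; exists (- 1 *: q); first by exists q.
  exists (- k); first exact: o_symmetricN.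
  by rewrite !scaleN1r opprD.
rewrite area_dilate ?oppr_eq0 ?oner_neq0//; last exact: msum_compact.
by rewrite sqrrN expr1n mul1r.
Qed.

(** The two generating segments are added to [K] one after the other.  When [v] is
    added, [det2 v] varies on K + [0, u] by |det2 u v| more than on [K]. *)
Lemma excess_parallelogram p u v :
  excess (parallelogram p u v) =
  2 * hwidth K u + 2 * hwidth K v + `|det2 u v|.
Proof.
have [cK vK _ _] := bK.
have cSu := @plane_segment_compact R 0 u; have cSv := @plane_segment_compact R 0 v.
have vSu := @segment_convex R 0 u.
have cKu := msum_compact cK cSu.
have -> : parallelogram p u v = translate p (msum (segment 0 u) (segment 0 v)).
  apply/seteqP; split => [_ [s [t [s01 t01 ->]]]|].
    exists (s *: u + t *: v); last by rewrite addrA.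
    exists (s *: u); first by apply/segment0P; exists s.
    by exists (t *: v) => //; apply/segment0P; exists t.
  move=> _ [_ [_ /segment0P[s s01 ->] [_ /segment0P[t t01 ->] <-]] <-].
  by exists s, t; rewrite addrA.
rewrite excess_translate; last exact: msum_compact.
rewrite /excess.
(* The segments are moved to the right of [K] to apply [area_msum_segment]. *)
have -> : msum (msum (segment 0 u) (segment 0 v)) K =
    msum (msum K (segment 0 u)) (segment 0 v).
  apply/seteqP; split => [_ [_ [x ux [y vy <-]] [k Kk <-]]|].
    exists (k + x); first by exists k => //; exists x.
    by exists y => //; rewrite [RHS]addrC addrA.
  move=> _ [_ [k Kk [x ux <-]] [y vy <-]].
  exists (x + y); first by exists x => //; exists y.
  by exists k => //; rewrite [LHS]addrC addrA.
have [ku Kku kuE] := hwidth_max u; have [ku' Kku' ku'E] := hwidth_min u.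
have [kv Kkv kvE] := hwidth_max v; have [kv' Kkv' kv'E] := hwidth_min v.
have end0 : segment 0 u 0.
  by exists 0; rewrite ?lexx ?ler01// scaler0 add0r scale0r.
have end1 : segment 0 u u.
  by exists 1; rewrite ?lexx ?ler01// scaler0 add0r scale1r.
have areaKu : area (msum K (segment 0 u)) = area K + 2 * hwidth K u.
  rewrite (@area_msum_segment R K u ku' ku)// ?kuE ?ku'E; first by ring.
  by move=> z Kz; rewrite hwidth_ge ?hwidth_le.
have vKu := msum_convex vK vSu.
have Ku_ge x : msum K (segment 0 u) x ->
    - hwidth K v + Num.min 0 (det2 v u) <= det2 v x <=
    hwidth K v + Num.max 0 (det2 v u).
  move=> [k Kk [_ /segment0P[t /andP[t0 t1] ->] <-]].
  have /andP[tmin tmax] : Num.min 0 (det2 v u) <= t * det2 v u <= Num.max 0 (det2 v u).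
    by move: (det2 v u) => D; case: (leP 0 D) => D0; apply/andP; split; nra.
  rewrite det2Dr det2Zr; apply/andP; split; apply: lerD => //.
  - exact: hwidth_le.
  - exact: hwidth_ge.
rewrite (det2_anti u v) normrN.
have [uv|uv] := leP 0 (det2 v u).
  rewrite (@area_msum_segment R _ v kv' (kv + u))//.
  - by rewrite areaKu ger0_norm// det2Dr kvE kv'E; ring.
  - by exists kv' => //; exists 0; rewrite ?addr0.
  - by exists kv => //; exists u.
  - by move=> z /Ku_ge; rewrite (min_idPl _)// (max_idPr _)// det2Dr kvE kv'E addr0.
rewrite (@area_msum_segment R _ v (kv' + u) kv)//.
- by rewrite areaKu ltr0_norm// det2Dr kvE kv'E; ring.
- by exists kv' => //; exists u.
- by exists kv => //; exists 0; rewrite ?addr0.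
- have uv' := ltW uv; move=> z /Ku_ge; rewrite (min_idPr _)// (max_idPl _)//.
  by rewrite det2Dr kvE kv'E addr0.
Qed.

Lemma excess_segment p q : excess (segment p q) = 2 * hwidth K (q - p).
Proof.
have -> : segment p q = parallelogram p (q - p) 0.
  apply/seteqP; split => [_ [t t01 ->]|_ [s [t [s01 t01 ->]]]].
    exists t, t; split => //.
    by plane_ring.
  exists s => //.
  by plane_ring.
rewrite excess_parallelogram det2_anti /det2 /= !mul0r subrr oppr0 normr0 addr0.
have w0 : hwidth K 0 = 0 by rewrite -(scale0r (0 : plane R)) hwidthZ// mul0r.
by rewrite w0 mulr0 addr0.
Qed.

Lemma excess_cut Q e (c : R) : compact Q -> convex_set Q ->
  excess (Q `&` [set x | det2 e x <= c]) +
    excess (Q `&` [set x | c <= det2 e x]) =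
  excess Q + excess (Q `&` [set x | det2 e x = c]).
Proof.
have [cK vK _ _] := bK => cQ vQ.
by have := area_msum_cut e c cQ vQ cK vK; rewrite /excess; lra.
Qed.

Lemma excess_le P Q : compact P -> compact Q -> P `<=` Q -> excess P <= excess Q.
Proof.
have [cK _ _ _] := bK => cP cQ PQ; rewrite /excess lerD2r.
apply: area_le; [exact: msum_compact|exact: msum_compact|].
by move=> _ [q /PQ Qq [k Kk <-]]; exists q => //; exists k.
Qed.

End SymBody.

(** The sides parallel to [v] have lengths [al] and [be] in units of [v], and [u]
    is one of the two legs.  With be = 0 this is a triangle. *)
Definition trapezoid p u v (al be : R) : set (plane R) :=
  [set x | exists s r : R,
     [/\ 0 <= s <= 1, 0 <= r <= (1 - s) * al + s * be &
         x = p + s *: u + r *: v]].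

Lemma parallelogram_convex p u v : convex_set (parallelogram p u v).
Proof.
apply/convexP => x y t /andP[t0 t1].
move=> [a [b [/andP[a0 a1] /andP[b0 b1] ->]]] [a' [b' [/andP[? ?] /andP[? ?] ->]]].
exists ((1 - t) * a + t * a'), ((1 - t) * b + t * b'); split.
- by apply/andP; split; nra.
- by apply/andP; split; nra.
- by plane_ring.
Qed.

Lemma parallelogram_compact p u v : compact (parallelogram p u v).
Proof.
have -> : parallelogram p u v =
    msum (segment p (p + u)) (segment 0 v).
  apply/seteqP; split => [_ [s [t [s01 t01 ->]]]|].
    exists (p + s *: u).
      exists s => //.
      by plane_ring.
    by exists (t *: v) => //; apply/segment0P; exists t.
  move=> _ [_ [s s01 ->] [_ /segment0P[t t01 ->] <-]].
  exists s, t; split => //.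
  by plane_ring.
by apply: msum_compact; exact: plane_segment_compact.
Qed.

(** A line through the centre of a parallelogram cuts it into a trapezoid and the
    reflection of this trapezoid in the centre.  The sides parallel to [v] have length
    al + be for the line that cuts off [al] from one and [be] from the other to pass
    through the centre. *)
Lemma trapezoid_cut p u v (al be : R) : 0 <= al -> 0 <= be -> det2 u v != 0 ->
  let P := parallelogram p u ((al + be) *: v) in
  let e := det2 u v *: (u + (be - al) *: v) in
  let c := det2 e (p + al *: v) in
  [/\ P `&` [set x | det2 e x <= c] = trapezoid p u v al be,
      P `&` [set x | c <= det2 e x] =
        translate (2 *: p + u + (al + be) *: v)
          (dilate (- 1) (trapezoid p u v al be)) &
      P `&` [set x | det2 e x = c] = segment (p + al *: v) (p + u + be *: v)].
Proof.
move=> al0 be0 D0 P e c.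
have D2 : 0 < det2 u v ^+ 2 by rewrite exprn_even_gt0.
(* The square of [det2 u v] makes the side of the cut independent of the
   orientation of [u] and [v]. *)
have eE (s r : R) : det2 e (p + s *: u + r *: v) - c =
    det2 u v ^+ 2 * (r - ((1 - s) * al + s * be)).
  rewrite /c !det2Dr !det2Zr /e !det2Zl !det2Dl !det2Zl !det2xx (det2_anti v u).
  by ring.
have le_cE (s r : R) : (det2 e (p + s *: u + r *: v) <= c) =
    (r <= (1 - s) * al + s * be).
  by rewrite -subr_le0 eE pmulr_rle0// subr_le0.
have ge_cE (s r : R) : (c <= det2 e (p + s *: u + r *: v)) =
    ((1 - s) * al + s * be <= r).
  by rewrite -subr_ge0 eE pmulr_rge0// subr_ge0.
have scE (t : R) : t *: ((al + be) *: v) = (t * (al + be)) *: v.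
  by rewrite scalerA.
have PE x : P x <-> exists s r : R, [/\ 0 <= s <= 1, 0 <= r <= al + be &
    x = p + s *: u + r *: v].
  split => [[s [t [s01 /andP[t0 t1] ->]]]|[s [r [s01 /andP[r0 rab] ->]]]].
    exists s, (t * (al + be)); rewrite scE; split => //.
    by apply/andP; split; nra.
  have [ab0|ab0] := eqVneq (al + be) 0.
    exists s, 0; split; rewrite ?lexx ?ler01// scE mul0r.
    by congr (_ + _ *: _); apply/eqP; rewrite eq_le r0 andbT -ab0.
  have ab_gt0 : 0 < al + be by rewrite lt_neqAle eq_sym ab0 addr_ge0.
  exists s, (r / (al + be)); rewrite scE divfK//; split => //.
  by rewrite divr_ge0 ?addr_ge0//= ler_pdivrMr// mul1r.
split; apply/seteqP; split.
- move=> _ [/PE[s [r [s01 /andP[r0 rab] ->]]] /=]; rewrite le_cE => rle.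
  by exists s, r; rewrite r0.
- move=> _ [s [r [s01 /andP[r0 rle] ->]]]; split => /=; last by rewrite le_cE.
  apply/PE; exists s, r; split => //; rewrite r0 (le_trans rle)//.
  by case/andP: s01 => ? ?; nra.
- move=> _ [/PE[s [r [/andP[s0 s1] /andP[r0 rab] ->]]] /=]; rewrite ge_cE => rge.
  exists (- 1 *: (p + (1 - s) *: u + (al + be - r) *: v)).
    exists (p + (1 - s) *: u + (al + be - r) *: v) => //.
    by exists (1 - s), (al + be - r); split => //; apply/andP; split; nra.
  by plane_ring.
- move=> _ [_ [_ [s [r [/andP[s0 s1] /andP[r0 rle] ->]]] <-] <-].
  have -> : 2 *: p + u + (al + be) *: v + -1 *: (p + s *: u + r *: v) =
      p + (1 - s) *: u + (al + be - r) *: v.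
    by plane_ring.
  split; last by rewrite /= ge_cE; nra.
  apply/PE; exists (1 - s), (al + be - r); split => //.
    by apply/andP; split; nra.
  by apply/andP; split; nra.
- move=> _ [/PE[s [r [s01 /andP[r0 rab] ->]]] /= rc].
  have rE : r = (1 - s) * al + s * be.
    by apply/eqP; rewrite eq_le -le_cE -ge_cE rc lexx.
  by exists s => //; rewrite rE; plane_ring.
- move=> _ [s s01 ->].
  have -> : (1 - s) *: (p + al *: v) + s *: (p + u + be *: v) =
      p + s *: u + ((1 - s) * al + s * be) *: v.
    by plane_ring.
  split; last by apply/eqP; rewrite eq_le le_cE ge_cE lexx.
  apply/PE; exists s, ((1 - s) * al + s * be); split => //.
  by case/andP: s01 => ? ?; apply/andP; split; nra.
Qed.

Lemma trapezoid_compact p u v (al be : R) :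
  0 <= al -> 0 <= be -> det2 u v != 0 -> compact (trapezoid p u v al be).
Proof.
move=> al0 be0 D0; have [<- _ _] := trapezoid_cut p al0 be0 D0.
apply: compact_closedI; first exact: parallelogram_compact.
by have [] := halfplane_closed (det2 u v *: (u + (be - al) *: v))
  (det2 (det2 u v *: (u + (be - al) *: v)) (p + al *: v)).
Qed.

(** By [trapezoid_cut] and the symmetry of [K], the excess of a trapezoid is half of
    the sum of the excess of the parallelogram and that of the cutting segment. *)
Lemma excess_trapezoid K p u v (al be : R) : sym_body K ->
  0 <= al -> 0 <= be -> det2 u v != 0 ->
  excess K (trapezoid p u v al be) =
  hwidth K u + hwidth K (u + (be - al) *: v) +
  (al + be) * (hwidth K v + `|det2 u v| / 2).
Proof.
move=> bK al0 be0 D0.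
have ab0 : 0 <= al + be by rewrite addr_ge0.
have cS : compact (trapezoid p u v al be) by exact: trapezoid_compact.
have [E1 E2 E3] := trapezoid_cut p al0 be0 D0.
have := excess_cut bK (det2 u v *: (u + (be - al) *: v))
  (det2 (det2 u v *: (u + (be - al) *: v)) (p + al *: v))
  (@parallelogram_compact p u ((al + be) *: v))
  (@parallelogram_convex p u ((al + be) *: v)).
rewrite E1 E2 E3 excess_translate//; last first.
  by apply: image_compact => // x; exact: scaler_continuous.
rewrite excess_opp// excess_segment// excess_parallelogram// hwidthZ//.
rewrite det2Zr normrM ger0_norm//.
have -> : p + u + be *: v - (p + al *: v) = u + (be - al) *: v.
  by plane_ring.
lra.
Qed.

End Excess.

(** * Convex hulls of finite sets *)

Section Hull.
Context {R : realType}.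
Implicit Types (A B K Q M P : set (plane R)) (x y z p q u v e : plane R).

Lemma chull_sub A C : convex_set C -> A `<=` C -> chull A `<=` C.
Proof. by move=> cC AC; exact: smallest_sub. Qed.

Lemma sub_chull A : A `<=` chull A.
Proof. exact: sub_gen_smallest. Qed.

Lemma chull_convex A : convex_set (chull A).
Proof.
apply/convexP => x y t t01 Ax Ay C [cC AC].
by move/convexP: (cC); apply => //; [exact: Ax|exact: Ay].
Qed.

Lemma chullS A B : A `<=` B -> chull A `<=` chull B.
Proof.
move=> AB; apply: chull_sub; first exact: chull_convex.
by move=> x /AB; exact: sub_chull.
Qed.

Lemma chull_set0 : chull set0 = set0 :> set (plane R).
Proof.
apply/seteqP; split => //; apply: chull_sub => //.
Qed.

Lemma chull_set1 p : chull [set p] = [set p].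
Proof.
apply/seteqP; split => [|x ->]; last exact: sub_chull.
apply: chull_sub => //; apply/convexP => _ _ t _ -> ->.
by rewrite -scalerDl subrK scale1r.
Qed.

Lemma chull_setU1 p A : A !=set0 ->
  chull (p |` A) =
  [set x | exists t y, [/\ 0 <= t <= 1, chull A y & x = (1 - t) *: p + t *: y]].
Proof.
move=> [a Aa]; apply/seteqP; split; last first.
  move=> _ [t [y [t01 Ay ->]]]; have /convexP := @chull_convex (p |` A); apply=> //.
    by apply: sub_chull; left.
  by apply: chullS Ay => x; right.
apply: chull_sub; last first.
  move=> x [->|Ax]; last first.
    exists 1, x; rewrite subrr scale0r add0r scale1r lexx ler01; split => //.
    exact: sub_chull.
  exists 0, a; rewrite subr0 scale1r scale0r addr0 lexx ler01; split => //.
  exact: sub_chull.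
have /convexP cA := @chull_convex A.
apply/convexP => x x' t /andP[t0 t1] [r [y [/andP[r0 r1] Ay ->]]]
  [r' [y' [/andP[r'0 r'1] Ay' ->]]].
pose m := (1 - t) * r + t * r'.
have m0 : 0 <= m by rewrite /m; nra.
have m1 : m <= 1 by rewrite /m; nra.
have [mE|mN] := eqVneq m 0.
  exists 0, y; rewrite lexx ler01; split => //.
  have rE : (1 - t) * r = 0 by move: mE; rewrite /m; nra.
  have r'E : t * r' = 0 by move: mE; rewrite /m; nra.
  have -> : (1 - t) *: ((1 - r) *: p + r *: y) + t *: ((1 - r') *: p + r' *: y') =
      (1 - (1 - t) * r - t * r') *: p + ((1 - t) * r) *: y + (t * r') *: y'.
    by plane_ring.
  by rewrite rE r'E !subr0 !scale0r !addr0.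
have mgt0 : 0 < m by rewrite lt_neqAle eq_sym mN.
exists m, ((1 - t * r' / m) *: y + (t * r' / m) *: y'); split.
- by rewrite m0.
- apply: cA => //; rewrite divr_ge0 ?mulr_ge0//= ler_pdivrMr// mul1r /m.
  by rewrite lerDr mulr_ge0// subr_ge0.
- have E : 1 - t * r' / m = (1 - t) * r / m by rewrite /m in mN *; field.
  rewrite E; have -> (z z' : plane R) (k l : R) :
      m *: ((k / m) *: z + (l / m) *: z') = k *: z + l *: z'.
    by rewrite scalerDr !scalerA !mulrA ![m * _]mulrC !mulfK.
  rewrite /m.
  by plane_ring.
Qed.

Definition hull (s : seq (plane R)) := chull [set x | x \in s].

Lemma hull_nil : hull [::] = set0.
Proof. by rewrite -chull_set0; congr chull; apply/seteqP; split. Qed.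

Lemma hull_cons p s : s != [::] -> hull (p :: s) =
  [set x | exists t y, [/\ 0 <= t <= 1, hull s y & x = (1 - t) *: p + t *: y]].
Proof.
move=> s0; rewrite /hull -chull_setU1; last first.
  by case: s s0 => // q s _; exists q; rewrite /= mem_head.
congr chull; apply/seteqP; split => x /=; rewrite inE.
  by move=> /orP[/eqP|]; [left|right].
by move=> [->|->]; rewrite ?eqxx ?orbT.
Qed.

Lemma hull1 p : hull [:: p] = [set p].
Proof.
by rewrite -chull_set1; congr chull; apply/seteqP; split => x /=; rewrite inE => /eqP.
Qed.

Lemma hull2 p q : hull [:: p; q] = segment p q.
Proof.
rewrite hull_cons// hull1; apply/seteqP; split.
  by move=> _ [t [_ [t01 -> ->]]]; exists t.
by move=> _ [t t01 ->]; exists t, q.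
Qed.

Lemma hullS s s' : {subset s <= s'} -> hull s `<=` hull s'.
Proof. by move=> ss; apply: chullS => x; exact: ss. Qed.

Lemma mem_hull s x : x \in s -> hull s x.
Proof. by move=> xs; apply: sub_chull. Qed.

Lemma hull_convex s : convex_set (hull s).
Proof. exact: chull_convex. Qed.

Lemma hull_eq s s' : s =i s' -> hull s = hull s'.
Proof.
by move=> E; apply/seteqP; split; apply: hullS => x; rewrite E.
Qed.

Lemma hull_compact s : compact (hull s).
Proof.
elim: s => [|p s IHs]; first by rewrite hull_nil; exact: compact0.
have [->|s0] := eqVneq s [::].
  by rewrite hull1; exact: compact_set1.
rewrite hull_cons//.
have -> : [set x | exists t y,
      [/\ 0 <= t <= 1, hull s y & x = (1 - t) *: p + t *: y]] =
    (fun z : R * plane R => (1 - z.1) *: p + z.1 *: z.2) @`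
      (`[0, 1]%classic `*` hull s).
  apply/seteqP; split => [_ [t [y [t01 sy ->]]]|_ [[t y] [/= + sy] <-]].
    by exists (t, y) => //; split => //=; rewrite in_itv.
  by rewrite in_itv => t01; exists t, y.
apply: continuous_compact; last by apply: compact_setX => //; exact: segment_compact.
apply: continuous_subspaceT => -[t y]; apply: cvgD.
  by apply: cvgZr_tmp; apply: cvgB; [exact: cvg_cst|exact: cvg_fst].
by apply: cvgZ; [exact: cvg_fst|exact: cvg_snd].
Qed.

Lemma halfplane_convex e (c : R) : convex_set [set x | c <= det2 e x].
Proof.
apply/convexP => x y t /andP[t0 t1] /= cx cy.
by rewrite det2Dr !det2Zr; nra.
Qed.

Lemma hull_halfplane s e (c : R) :
  (forall x, x \in s -> c <= det2 e x) -> forall x, hull s x -> c <= det2 e x.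
Proof. by move=> sc; apply: chull_sub => //; exact: halfplane_convex. Qed.

(** The separating line passes through [p] and is orthogonal to the segment from
    [p] to the point of [C] nearest to [p]. *)
Lemma separation (C : set (plane R)) p :
  compact C -> convex_set C -> C !=set0 -> ~ C p ->
  exists d : plane R, forall x, C x -> det2 d p < det2 d x.
Proof.
move=> cC /convexP vC C0 Cp.
pose N x := (x.1 - p.1) ^+ 2 + (x.2 - p.2) ^+ 2 : R.
have cN : continuous (fun x => N x : R).
  move=> x; apply: cvgD; apply: cvgM; apply: cvgB;
    (exact: cvg_cst || exact: cvg_fst || exact: cvg_snd).
have [|y /set_mem Cy ymin] := @compact_EVT_min _ R N C C0 cC.
  exact: continuous_subspaceT.
pose n := y - p.
have n0 : 0 < n.1 ^+ 2 + n.2 ^+ 2.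
  apply: sqr_norm_gt0 => /eqP; rewrite subr_eq0 => /eqP yp.
  by apply: Cp; rewrite -yp.
exists (n.2, - n.1) => x Cx.
pose g : R := n.1 * (x.1 - y.1) + n.2 * (x.2 - y.2).
pose h : R := (x.1 - y.1) ^+ 2 + (x.2 - y.2) ^+ 2.
(* The increase of [N] on the way from [y] to (1 - t) y + t x. *)
have gh (t : R) : 0 <= t <= 1 -> 0 <= t * (2 * g + t * h).
  move=> t01; have /mem_set/ymin := vC y x t t01 Cy Cx.
  rewrite -subr_ge0; congr (0 <= _); rewrite /N /g /h /n /= /GRing.scale /=; ring.
have g0 : 0 <= g.
  rewrite leNgt; apply/negP => gN.
  have h0 : 0 <= h by rewrite addr_ge0 ?sqr_ge0.
  have k0 : 0 < h - g by lra.
  have t0 : 0 < - g / (h - g) by rewrite divr_gt0// oppr_gt0.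
  have t1 : - g / (h - g) <= 1 by rewrite ler_pdivrMr//; lra.
  (* At this [t], which lies between 0 and 1, 2 g + t h has the sign of [g]. *)
  have := gh (- g / (h - g)); rewrite (ltW t0) t1 => /(_ isT).
  rewrite pmulr_rge0//.
  have -> : 2 * g + - g / (h - g) * h = g * (h - 2 * g) / (h - g).
    by field; rewrite gt_eqF.
  by rewrite pmulr_lge0 ?invr_gt0//; nra.
rewrite /det2 /= -subr_gt0.
have -> : n.2 * x.2 - - n.1 * x.1 - (n.2 * p.2 - - n.1 * p.1) =
    g + (n.1 ^+ 2 + n.2 ^+ 2) by rewrite /g /n /=; ring.
by rewrite ltr_wpDl.
Qed.

End Hull.

(** * Points in convex position and the sides of their hull *)

Section ConvexPosition.
Context {R : realType}.
Implicit Types (A B K Q M P : set (plane R)) (x y z p q u v e : plane R).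
Implicit Types s : seq (plane R).

Definition convex_position s :=
  uniq s /\ forall p, p \in s -> ~ hull (rem p s) p.

(** Points in the hull of the others are dropped one by one. *)
Lemma convex_position_exists s :
  exists2 s', convex_position s' & hull s' = hull s.
Proof.
have [n] := ubnP (size s); elim: n s => // n IHn s; rewrite ltnS => sn.
have [us|us] := boolP (uniq s); last first.
  have [|s' cs' s'E] := IHn (undup s).
    by apply: leq_trans sn; rewrite ltn_size_undup.
  by exists s' => //; rewrite s'E; apply: hull_eq => x; rewrite mem_undup.
have [cs|] := pselect (forall p, p \in s -> ~ hull (rem p s) p).
  by exists s.
move=> /existsNP[p /not_implyP[ps /contrapT hp]].
have [|s' cs' s'E] := IHn (rem p s).
  by apply: leq_trans sn; rewrite size_rem// prednK//; case: (s) ps.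
exists s' => //; rewrite s'E; apply/seteqP; split.
  by apply: hullS => x /mem_rem.
apply: chull_sub; first exact: hull_convex.
move=> x /= xs; have [->//|xp] := eqVneq x p.
by apply: mem_hull; rewrite mem_rem_uniq// !inE xp.
Qed.

Lemma convex_position_behead p s : convex_position (p :: s) -> convex_position s.
Proof.
move=> [/= /andP[ps us] cs]; split => // q qs hq.
apply: (cs q); first by rewrite inE qs orbT.
apply: hullS hq => x; rewrite /=; case: eqP => [pq|_]; first by rewrite pq qs in ps.
by rewrite inE => ->; rewrite orbT.
Qed.

Lemma convex_position_hull p s t : convex_position s -> p \in s ->
  {subset t <= s} -> hull t p -> p \in t.
Proof.
move=> [us cs] ps ts hp; apply/negPn/negP => pt; apply: (cs p ps).
apply: hullS hp => x xt; rewrite mem_rem_uniq// !inE ts// andbT.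
by apply: contraNneq pt => <-.
Qed.

Lemma convex_position_segment s x y z : convex_position s ->
  x \in s -> y \in s -> z \in s -> segment y z x -> x = y \/ x = z.
Proof.
move=> cs xs ys zs; rewrite -hull2 => /(convex_position_hull cs xs).
have yzs : {subset [:: y; z] <= s} by move=> t; rewrite !inE => /orP[]/eqP->.
by move=> /(_ yzs); rewrite !inE => /orP[]/eqP; [left|right].
Qed.

(** Removing an extreme point from a convex set leaves a convex set.  If [p] were not
    in [s], this smaller set would still contain [s], hence also its hull. *)
Lemma extreme_point_mem s p : extreme_point (hull s) p -> p \in s.
Proof.
move=> [hp ep]; apply/negPn/negP => ps.
have : (hull s `\ p) p.
  move: (hp); apply: chull_sub.
    apply/convexP => x y t /andP[t0 t1] [hx xp] [hy yp].
    have /convexP vs := @hull_convex R s.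
    split; first by apply: vs => //; rewrite t0.
    move=> /= E.
    have [tE|tN] := eqVneq t 0.
      by apply: xp; rewrite /= -E tE subr0 scale1r scale0r addr0.
    have [tE|tN1] := eqVneq t 1.
      by apply: yp; rewrite /= -E tE subrr scale1r scale0r add0r.
    have [] := ep x y t hx hy _ (esym E) => //.
    by rewrite lt_neqAle eq_sym tN t0 lt_neqAle tN1.
  move=> x /= xs; split; first exact: mem_hull.
  by move=> /= xp; rewrite -xp xs in ps.
by case => _ /=.
Qed.

(** If [p] lies inside a segment of the hull, write the ends of the segment as convex
    combinations of [p] and points of the hull of the other elements of [s]; solving
    for [p] puts [p] into that hull, unless both ends are [p]. *)
Lemma mem_extreme_point s p : convex_position s -> p \in s ->
  extreme_point (hull s) p.
Proof.
move=> [us cs] ps; split; first exact: mem_hull.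
move=> x y t; have hpE : hull s = hull (p :: rem p s).
  by apply: hull_eq; apply: perm_mem; exact: perm_to_rem.
rewrite hpE; have [s0|s0] := eqVneq (rem p s) [::].
  by rewrite s0 hull1 => -> ->.
rewrite hull_cons// => -[a [x' [/andP[a0 a1] hx' ->]]] [b [y' [/andP[b0 b1] hy' ->]]].
move=> /andP[t0 t1] E.
pose m := (1 - t) * a + t * b.
have ta0 : 0 <= (1 - t) * a by rewrite mulr_ge0// subr_ge0 ltW.
have tb0 : 0 <= t * b by rewrite mulr_ge0// ltW.
have [mE|mN] := eqVneq m 0.
  have /eqP : (1 - t) * a = 0 by move: mE; rewrite /m; lra.
  rewrite mulf_eq0 subr_eq0 gt_eqF//= => /eqP ->.
  have /eqP : t * b = 0 by move: mE; rewrite /m; lra.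
  rewrite mulf_eq0 gt_eqF//= => /eqP ->.
  by rewrite subr0 !scale1r !scale0r !addr0.
exfalso; apply: (cs p ps).
have mgt0 : 0 < m by rewrite lt_neqAle eq_sym mN addr_ge0.
have pE : p = (1 - t * b / m) *: x' + (t * b / m) *: y'.
  have E1 : m *: p = ((1 - t) * a) *: x' + (t * b) *: y'.
    have : p - p = 0 by rewrite subrr.
    rewrite {1}E => E0; rewrite -[LHS]addr0 -E0 /m.
    by plane_ring.
  apply: (scalerI mN); rewrite E1 scalerDr !scalerA.
  by congr (_ *: _ + _ *: _); rewrite /m in mN *; field.
have /convexP vs := @hull_convex R (rem p s).
rewrite [X in hull _ X]pE; apply: vs => //.
rewrite divr_ge0 ?(ltW mgt0)//= ler_pdivrMr// mul1r /m.
by rewrite lerDr.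
Qed.

Lemma sides_hull s u v : convex_position s ->
  sides (hull s) (u, v) <->
  [/\ u <> v, u \in s, v \in s &
      forall x, x \in s -> 0 <= det2 (v - u) (x - u)].
Proof.
move=> cs; split => [[/= uv /extreme_point_mem us /extreme_point_mem vs uvQ]|].
  by split => // x xs; apply: uvQ; exact: mem_hull.
move=> [uv us vs uvs]; split => //=; [exact: mem_extreme_point..|].
move=> x hx; rewrite det2Dr det2Nr subr_ge0; apply: hull_halfplane hx => y ys.
by rewrite -subr_ge0 -det2Nr -det2Dr uvs.
Qed.

Lemma sides_finite_convex_position s : convex_position s -> finite_set (sides (hull s)).
Proof.
move=> cs; apply: (@sub_finite_set _ _ [set` [seq (u, v) | u <- s, v <- s]]).
  move=> [u v] /(sides_hull _ _ cs)[_ us vs _].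
  by apply/allpairsP; exists (u, v).
exact: finite_seq.
Qed.

End ConvexPosition.

(** * Cutting an ear off a polygon *)

Section EarExists.
Context {R : realType}.
Implicit Types (A B K Q M P : set (plane R)) (x y z p q u v e : plane R).
Implicit Types s : seq (plane R).

Lemma seq_argmax (T : eqType) (f : T -> R) (r : seq T) : r != [::] ->
  exists2 m, m \in r & forall x : T, x \in r -> f x <= f m.
Proof.
elim: r => // a r IHr _; have [->|/IHr[m mr mmax]] := eqVneq r [::].
  by exists a; [rewrite mem_head|move=> x; rewrite inE => /eqP ->].
have [am|ma] := leP (f a) (f m).
  by exists m => [|x]; rewrite inE ?mr ?orbT// => /orP[/eqP ->//|/mmax].
exists a => [|x]; rewrite inE ?eqxx// => /orP[/eqP ->//|/mmax xm].
by rewrite (le_trans xm)// ltW.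
Qed.

(** The lines from [p] to [t1] and to [t2] are the two supporting lines of [s] through
    [p].  The last condition says that the line through [t1] and [t2] separates [p]
    from [s], so that cutting along it removes just the triangle [p t1 t2]. *)
Definition ear p s t1 t2 :=
  [/\ t1 \in s, t2 \in s, 0 < det2 (t1 - p) (t2 - p) &
  [/\ forall x, x \in s -> 0 <= det2 (t1 - p) (x - p),
      forall x, x \in s -> 0 <= det2 (x - p) (t2 - p) &
      forall x, x \in s ->
        det2 (t1 - p) (t2 - p) <= det2 (t1 - t2) (x - p)]].

Lemma hull_triangle p q r (al be : R) : 0 <= al -> 0 <= be -> al + be <= 1 ->
  hull [:: p; q; r] (p + al *: (q - p) + be *: (r - p)).
Proof.
move=> al0 be0 ab1; have [ab0|ab0] := eqVneq (al + be) 0.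
  have [-> ->] : al = 0 /\ be = 0 by lra.
  by rewrite !scale0r !addr0; apply: mem_hull; rewrite mem_head.
have abgt0 : 0 < al + be by rewrite lt_neqAle eq_sym ab0 addr_ge0.
rewrite hull_cons// hull2.
exists (al + be), ((1 - be / (al + be)) *: q + (be / (al + be)) *: r); split.
- by rewrite addr_ge0.
- exists (be / (al + be)) => //.
  by rewrite divr_ge0 ?(ltW abgt0)//= ler_pdivrMr// mul1r lerDr.
- by plane_field.
Qed.

(** A line separates [p] from the hull of [s].  In coordinates along and across this
    line, the points of [s] are seen from [p] under slopes b / a with a > 0, and
    [t1], [t2] are the points with extremal slope.  If the two slopes were equal, all
    points would lie on one ray from [p]; this contradicts convex position, as does
    a further point in the triangle [p t1 t2]. *)
Lemma ear_exists p s : convex_position (p :: s) -> (1 < size s)%N ->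
  exists t1 t2, ear p s t1 t2.
Proof.
move=> cps s2; have [ups cs] := cps.
have s0 : s != [::] by case: (s) s2.
have [d ds] : exists d : plane R, forall x, x \in s -> det2 d p < det2 d x.
  have [||d dP] := @separation R (hull s) p (@hull_compact R s) (@hull_convex R s).
  - by case: (s) s0 => // q r _; exists q; apply: mem_hull; rewrite mem_head.
  - by have := cs p (mem_head _ _); rewrite /= eqxx.
  by exists d => x xs; apply: dP; exact: mem_hull.
pose a x := det2 d (x - p).
pose b x := dot d (x - p).
have a0 x : x \in s -> 0 < a x.
  by move=> xs; rewrite /a det2Dr det2Nr subr_gt0 ds.
have d0 : d <> 0.
  case: (s) s0 ds => // q r _ /(_ q (mem_head _ _)) + d0.
  by rewrite d0 /det2 !mul0r subrr ltxx.
have dd0 : 0 < dot d d by rewrite /dot -!expr2 sqr_norm_gt0.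
(* Lagrange identity in the orthogonal frame given by [d]. *)
have slope x y : det2 (x - p) (y - p) * dot d d = b x * a y - a x * b y.
  by rewrite /a /b /dot /det2 /=; ring.
have slope_ge x y : x \in s -> y \in s ->
    (0 <= det2 (x - p) (y - p)) = (b y / a y <= b x / a x).
  move=> xs ys; rewrite -(pmulr_lge0 _ dd0) slope subr_ge0.
  by rewrite ler_pdivrMr ?a0// mulrAC ler_pdivlMr ?a0// [a x * _]mulrC.
have [t1 t1s t1max] := seq_argmax (fun x => b x / a x) s0.
have [t2 t2s t2min] := seq_argmax (fun x => - (b x / a x)) s0.
have H1 x : x \in s -> 0 <= det2 (t1 - p) (x - p).
  by move=> xs; rewrite slope_ge// t1max.
have H2 x : x \in s -> 0 <= det2 (x - p) (t2 - p).
  by move=> xs; rewrite slope_ge// -lerN2 t2min.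
have sub x : x \in s -> x \in p :: s by move=> xs; rewrite inE xs orbT.
have Dgt0 : 0 < det2 (t1 - p) (t2 - p).
  rewrite lt_neqAle H1// andbT eq_sym; apply/eqP => D0.
  have slopeE x : x \in s -> b x / a x = b t1 / a t1.
    move=> xs; apply/eqP; rewrite eq_le t1max//=.
    have : 0 <= det2 (t2 - p) (t1 - p) by rewrite det2_anti D0 oppr0.
    rewrite slope_ge// => /le_trans; apply.
    by rewrite -lerN2 t2min.
  have collinear x y : x \in s -> y \in s -> a x <= a y -> x = y.
    move=> xs ys axy; have axy' : segment p y x.
      exists (a x / a y).
        by rewrite divr_ge0 ?(ltW (a0 _ _))//= ler_pdivrMr ?a0// mul1r.
      have ax0 := a0 _ xs; have ay0 := a0 _ ys.
      have bE : b x = a x / a y * b y.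
        have := slopeE _ xs; rewrite -(slopeE _ ys) => E.
        by rewrite -(divfK (lt0r_neq0 ax0) (b x)) E; ring.
      have aE : a x = a x / a y * a y by rewrite divfK// gt_eqF.
      have : x - p = (a x / a y) *: (y - p).
        move: (a x / a y) bE aE => t bE aE.
        apply/eqP; rewrite -subr_eq0; apply/eqP/(det2_dot_eq0 d0).
          by rewrite det2Dr det2Nr det2Zr; apply/eqP; rewrite subr_eq0; apply/eqP.
        transitivity (b x - t * b y); last by rewrite bE subrr.
        by rewrite /b /dot /= /GRing.scale /=; ring.
      move=> E; rewrite -[x in LHS](subrK p) E.
      by plane_ring.
    have [xp|//] := convex_position_segment cps (sub _ xs) (mem_head _ _)
      (sub _ ys) axy'.
    by move: ups; rewrite /= -xp xs.
  have [us _] := convex_position_behead cps.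
  case: (s) s2 us collinear => [|x [|y r]]//= _ /andP[xyr _] coll.
  have xs : x \in [:: x, y & r] by rewrite mem_head.
  have ys : y \in [:: x, y & r] by rewrite !inE eqxx orbT.
  suff xy : x = y by rewrite xy mem_head in xyr.
  have [axy|/ltW ayx] := leP (a x) (a y); first exact: coll.
  by apply/esym; exact: coll.
exists t1, t2; split => //; split => // x xs.
rewrite leNgt; apply/negP => xD.
pose D := det2 (t1 - p) (t2 - p).
pose al := det2 (x - p) (t2 - p) / D; pose be := det2 (t1 - p) (x - p) / D.
have al0 : 0 <= al by rewrite divr_ge0 ?H2 ?ltW.
have be0 : 0 <= be by rewrite divr_ge0 ?H1 ?ltW.
have xE : x = p + al *: (t1 - p) + be *: (t2 - p).
  by rewrite -addrA -det2_coordinates ?gt_eqF// addrC subrK.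
have ab1 : al + be < 1.
  rewrite -mulrDl ltr_pdivrMr// mul1r; apply: le_lt_trans xD.
  by rewrite /det2 /=; lra.
have : x \in [:: p; t1; t2].
  apply: (convex_position_hull cps (sub _ xs)).
    by move=> y; rewrite !inE => /or3P[]/eqP->; rewrite ?eqxx// -in_cons sub.
  by rewrite xE; apply: hull_triangle => //; exact: ltW.
move: xD; rewrite !inE => xD /or3P[]/eqP xE'.
- by move: ups; rewrite /= -xE' xs.
- by move: xD; rewrite xE' det2Dl det2Nl det2Dr det2Nr det2Dl det2Nl /det2 /=; lra.
- by move: xD; rewrite xE' /det2 /=; lra.
Qed.

End EarExists.

Section EarCut.
Context {R : realType}.
Implicit Types (A B K Q M P : set (plane R)) (x y z p q u v e : plane R).
Implicit Types s : seq (plane R).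

Lemma ear_cut p s t1 t2 : ear p s t1 t2 ->
  let e := t1 - t2 in let c := det2 e t1 in let Q := hull (p :: s) in
  [/\ Q `&` [set x | det2 e x <= c] = trapezoid p (t2 - p) (t1 - p) 1 0,
      Q `&` [set x | c <= det2 e x] = hull s &
      Q `&` [set x | det2 e x = c] = segment t1 t2].
Proof.
move=> [t1s t2s D0 [H1 H2 H3]] e c Q.
pose D := det2 (t1 - p) (t2 - p).
have s0 : s != [::] by case: (s) t1s.
have ecE (al be : R) : det2 e (p + al *: (t1 - p) + be *: (t2 - p)) - c =
    D * (al + be - 1).
  by rewrite /c /e /D /det2 /= /GRing.scale /=; ring.
have coord y : hull s y -> exists al be : R,
    [/\ 0 <= al, 0 <= be, 1 <= al + be & y = p + al *: (t1 - p) + be *: (t2 - p)].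
  move=> sy; exists (det2 (y - p) (t2 - p) / D), (det2 (t1 - p) (y - p) / D); split.
  - apply: divr_ge0 (ltW D0); rewrite det2_anti -det2Nl det2Dr det2Nr subr_ge0.
    apply: hull_halfplane sy => x xs.
    by rewrite -subr_ge0 -det2Nr -det2Dr det2Nl -det2_anti H2.
  - apply: divr_ge0 (ltW D0); rewrite det2Dr det2Nr subr_ge0.
    by apply: hull_halfplane sy => x xs; rewrite -subr_ge0 -det2Nr -det2Dr H1.
  - rewrite -mulrDl ler_pdivlMr// mul1r.
    have : D + det2 e p <= det2 e y.
      apply: hull_halfplane sy => x xs.
      by rewrite -lerBrDr -det2Nr -det2Dr; exact: H3.
    by rewrite /D /e /det2 /=; lra.
  - by rewrite -addrA -det2_coordinates ?gt_eqF// addrC subrK.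
have QE x : Q x -> exists t al be : R, [/\ 0 <= t <= 1,
    [/\ 0 <= al, 0 <= be & 1 <= al + be],
    hull s (p + al *: (t1 - p) + be *: (t2 - p)) &
    x = p + (t * al) *: (t1 - p) + (t * be) *: (t2 - p)].
  rewrite /Q hull_cons// => -[t [y [t01 sy ->]]].
  have [al [be [al0 be0 ab1 yE]]] := coord y sy.
  exists t, al, be; rewrite -yE; split => //; rewrite yE.
  by plane_ring.
have TQ : trapezoid p (t2 - p) (t1 - p) 1 0 `<=` Q.
  move=> _ [u [v [/andP[u0 u1] /andP[v0 v1] ->]]].
  have : {subset [:: p; t1; t2] <= p :: s}.
    by move=> x; rewrite !inE => /or3P[]/eqP->; rewrite ?eqxx ?t1s ?t2s ?orbT.
  move=> /hullS; apply; rewrite addrAC; apply: hull_triangle => //; lra.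
have sQ : hull s `<=` Q by apply: hullS => x xs; rewrite inE xs orbT.
have QT x : Q x -> det2 e x <= c -> trapezoid p (t2 - p) (t1 - p) 1 0 x.
  move=> /QE[t [al [be [/andP[t0 t1'] [al0 be0 ab1] _ ->]]]].
  rewrite -subr_le0 ecE pmulr_rle0// => le1.
  exists (t * be), (t * al); split.
  - by rewrite mulr_ge0//=; nra.
  - by rewrite mulr_ge0//=; nra.
  - by rewrite addrAC.
have Tc x : trapezoid p (t2 - p) (t1 - p) 1 0 x -> det2 e x <= c.
  move=> [u [v [/andP[u0 u1] /andP[v0 v1] ->]]].
  by rewrite addrAC -subr_le0 ecE pmulr_rle0//; lra.
split; apply/seteqP; split.
- by move=> x [Qx /= xc]; exact: QT.
- by move=> x Tx; split; [exact: TQ|exact: Tc].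
- move=> x [/QE[t [al [be [/andP[t0 t1'] [al0 be0 ab1] sy ->]]]] /=].
  rewrite -subr_ge0 ecE pmulr_rge0// => ge1.
  have /convexP vs := @hull_convex R s.
  have [ab|ab] := eqVneq (al + be) 1.
    have -> : t = 1 by nra.
    by rewrite !mul1r.
  have sg1 : 0 < al + be - 1 by rewrite subr_gt0 lt_neqAle eq_sym ab.
  have sg0 : al + be != 0 by rewrite gt_eqF//; lra.
  (* The ray from [p] through the point with coordinates [al], [be] meets the
     segment t1 t2 here, and the point with coordinates t al, t be lies between
     these two points of the hull. *)
  have sm : hull s (p + (al / (al + be)) *: (t1 - p) + (be / (al + be)) *: (t2 - p)).
    have -> : p + (al / (al + be)) *: (t1 - p) + (be / (al + be)) *: (t2 - p) =
        (1 - be / (al + be)) *: t1 + (be / (al + be)) *: t2.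
      by plane_field.
    apply: vs; [|exact: mem_hull..].
    by rewrite divr_ge0 ?addr_ge0//= ler_pdivrMr ?mul1r ?lerDr//; lra.
  have := vs _ _ ((t * (al + be) - 1) / (al + be - 1)) _ sm sy.
  rewrite divr_ge0 ?(ltW sg1)//=; last lra.
  rewrite ler_pdivrMr// mul1r lerD2r ler_piMl//; last lra.
  move=> /(_ isT); congr (hull s).
  by plane_field; rewrite sg0 gt_eqF.
- move=> x sx; split; first exact: sQ.
  have [al [be [al0 be0 ab1 ->]]] := coord x sx.
  by rewrite /= -subr_ge0 ecE mulr_ge0 ?(ltW D0)// subr_ge0.
- move=> x [Qx /= xc]; have [|u [v [/andP[u0 u1] /andP[v0 v1] xE]]] := QT x Qx.
    by rewrite xc.
  move: xc => /eqP; rewrite -subr_eq0 xE (addrAC p) ecE mulf_eq0 gt_eqF//= => /eqP uv1.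
  exists u; first by rewrite u0.
  have -> : v = 1 - u by lra.
  by plane_ring.
- move=> _ [u /andP[u0 u1] ->].
  have E : (1 - u) *: t1 + u *: t2 = p + (1 - u) *: (t1 - p) + u *: (t2 - p).
    by plane_ring.
  split.
    apply: TQ; exists u, (1 - u); split; first by rewrite u0.
      by apply/andP; split; lra.
    by rewrite E addrAC.
  by apply/eqP; rewrite /= E -subr_eq0 ecE subrK subrr mulr0.
Qed.

(** A side of the hull of [s] other than (t2, t1) remains a side when [p] is added:
    otherwise [p] would lie strictly beyond it, while [t1] and [t2] do not, and since
    [s] lies beyond the line t1 t2 as seen from [p], both ends of the side would lie
    on the segment from [t1] to [t2]. *)
Lemma ear_sides p s t1 t2 : convex_position (p :: s) -> ear p s t1 t2 ->
  [/\ sides (hull s) (t2, t1), sides (hull (p :: s)) (p, t1),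
      sides (hull (p :: s)) (t2, p) &
      sides (hull (p :: s)) `\ (p, t1) `\ (t2, p) = sides (hull s) `\ (t2, t1)].
Proof.
move=> cps [t1s t2s D0 [H1 H2 H3]].
have cs := convex_position_behead cps.
have ps : p \notin s by case: cps => /= /andP[].
have sub x : x \in s -> x \in p :: s by move=> xs; rewrite inE xs orbT.
pose D := det2 (t1 - p) (t2 - p).
have t12 : t1 <> t2 by move=> E; move: D0; rewrite E det2xx ltxx.
have notp x : x \in s -> x <> p by move=> + xp; rewrite xp; apply/negP.
have coord x : x \in s -> exists al be : R,
    [/\ 0 <= al, 0 <= be, 1 <= al + be & x = p + al *: (t1 - p) + be *: (t2 - p)].
  move=> xs; exists (det2 (x - p) (t2 - p) / D), (det2 (t1 - p) (x - p) / D); split.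
  - by rewrite divr_ge0 ?H2 ?ltW.
  - by rewrite divr_ge0 ?H1 ?ltW.
  - rewrite -mulrDl ler_pdivlMr// mul1r; apply: le_trans (H3 _ xs) _.
    by rewrite /det2 /=; lra.
  - by rewrite -addrA -det2_coordinates ?gt_eqF// addrC subrK.
split.
- apply/(sides_hull _ _ cs); split => //; first by move=> /esym.
  by move=> x xs; have := H3 _ xs; rewrite /det2 /=; lra.
- apply/(sides_hull _ _ cps); rewrite mem_head sub//; split => //.
    by move=> /esym; exact: notp.
  by move=> x; rewrite inE => /orP[/eqP ->|/H1//]; rewrite subrr /det2 /=; lra.
- apply/(sides_hull _ _ cps); rewrite mem_head sub//; split => //; first exact: notp.
  move=> x; rewrite inE => /orP[/eqP ->|xs]; first by rewrite det2xx.
  by have := H2 _ xs; rewrite /det2 /=; lra.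
apply/seteqP; split => -[u v].
  move=> [[/(sides_hull _ _ cps)[uv]]].
  rewrite !inE => /orP[/eqP uE|us] /orP[/eqP vE|vs] uvP /= n1 n2.
  - by rewrite uE vE in uv.
  - exfalso; have [al [be [al0 be0 ab1 vE]]] := coord v vs.
    have : 0 <= det2 (v - u) (t1 - u) by apply: uvP; exact: sub.
    rewrite uE vE => H; have be_eq0 : be = 0.
      have E : det2 (p + al *: (t1 - p) + be *: (t2 - p) - p) (t1 - p) = - be * D.
        by rewrite /D /det2 /= /GRing.scale /=; ring.
      by apply/eqP; rewrite eq_le be0 andbT -(pmulr_lle0 _ D0) -oppr_ge0 -mulNr -/D -E.
    have al1 : 1 <= al by lra.
    have [|t1p|t1v] := convex_position_segment cps (sub _ t1s) (mem_head _ _) (sub _ vs).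
    + exists al^-1; first by rewrite invr_ge0 al0 invf_le1//; lra.
      rewrite vE be_eq0.
      by plane_field; rewrite gt_eqF//; lra.
    + by case: (notp _ t1s).
    + by apply: n1; rewrite uE t1v.
  - exfalso; have [al [be [al0 be0 ab1 uE]]] := coord u us.
    have : 0 <= det2 (v - u) (t2 - u) by apply: uvP; exact: sub.
    rewrite vE uE => H; have al_eq0 : al = 0.
      have E : det2 (p - (p + al *: (t1 - p) + be *: (t2 - p)))
          (t2 - (p + al *: (t1 - p) + be *: (t2 - p))) = - al * D.
        by rewrite /D /det2 /= /GRing.scale /=; ring.
      by apply/eqP; rewrite eq_le al0 andbT -(pmulr_lle0 _ D0) -oppr_ge0 -mulNr -/D -E.
    have be1 : 1 <= be by lra.
    have [|t2p|t2u] := convex_position_segment cps (sub _ t2s) (mem_head _ _) (sub _ us).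
    + exists be^-1; first by rewrite invr_ge0 be0 invf_le1//; lra.
      rewrite uE al_eq0.
      by plane_field; rewrite gt_eqF//; lra.
    + by case: (notp _ t2s).
    + by apply: n2; rewrite vE t2u.
  - split; first by apply/(sides_hull _ _ cs); split => // x xs; exact/uvP/sub.
    move=> /= [uE vE]; have := uvP p (mem_head _ _); rewrite uE vE.
    by move: D0; rewrite /det2 /=; lra.
move=> [/(sides_hull _ _ cs)[uv us vs uvP] /= n12].
split; last by move=> [_]; exact: notp.
split; last by move=> /= [] /(notp _ us).
apply/(sides_hull _ _ cps); split; [by []|exact: sub|exact: sub|].
move=> x; rewrite inE => /orP[/eqP ->|]; last exact: uvP.
rewrite leNgt; apply/negP => lp.
have on_edge w : w \in s -> det2 (v - u) (w - u) = 0 -> w = t1 \/ w = t2.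
  move=> ws w0; have [al [be [al0 be0 ab1 wE]]] := coord w ws.
  have := uvP _ t1s; have := uvP _ t2s => l2 l1.
  (* All three terms are nonnegative, and the first one vanishes only if
     al + be = 1. *)
  have E : (1 - al - be) * det2 (v - u) (p - u) + al * det2 (v - u) (t1 - u) +
      be * det2 (v - u) (t2 - u) = 0.
    by rewrite -w0 wE /det2 /= /GRing.scale /=; ring.
  have ab : al + be = 1 by nra.
  apply: (convex_position_segment cps (sub _ ws) (sub _ t1s) (sub _ t2s)).
  exists be; first by apply/andP; split; lra.
  have -> : 1 - be = al by lra.
  have alE : al = 1 - be by lra.
  by rewrite wE alE; plane_ring.
have u0 : det2 (v - u) (u - u) = 0 by rewrite subrr /det2 /=; ring.
have v0 := det2xx (v - u).
have [uE|uE] := on_edge u us u0; have [vE|vE] := on_edge v vs v0.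
- by apply: uv; rewrite uE vE.
- by move: lp D0; rewrite uE vE /det2 /=; lra.
- by apply: n12; rewrite uE vE.
- by apply: uv; rewrite uE vE.
Qed.

End EarCut.

(** * The Steiner formula for polygons *)

Section Steiner.
Context {R : realType}.
Implicit Types (A B K Q M P : set (plane R)) (x y z p q u v e : plane R).
Implicit Types s : seq (plane R).

Lemma sym_body0 : sym_body ([set 0] : set (plane R)).
Proof.
split; [exact: compact_set1| | |by exists 0].
- by rewrite -chull_set1; exact: chull_convex.
- apply/seteqP; split => [x ->|_ [x -> <-]]; last by rewrite oppr0.
  by exists 0; rewrite ?oppr0.
Qed.

Lemma hwidth_set0 e : hwidth [set 0 : plane R] e = 0.
Proof.
have det0 : det2 e (0 : plane R) = 0 by rewrite /det2 /= !mulr0 subrr.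
by apply: hwidth_eq => [x ->|]; [rewrite det0|exists 0].
Qed.

Lemma msum0 Q : msum Q [set 0] = Q.
Proof.
apply/seteqP; split => [_ [q Qq [_ -> <-]]|q Qq]; first by rewrite addr0.
by exists q => //; exists 0 => //; rewrite addr0.
Qed.

Lemma area_set1_0 : area [set 0 : plane R] = 0.
Proof.
have c0 : compact [set 0 : plane R] by exact: compact_set1.
(* [set 0] is its own dilate by 2, so its area is 4 times itself. *)
have := @area_dilate R 2 [set 0] _ c0.
have -> : dilate 2 [set 0 : plane R] = [set 0].
  apply/seteqP; split => [_ [_ -> <-]|_ ->]; first by rewrite scaler0.
  by exists 0; rewrite ?scaler0.
by rewrite pnatr_eq0 => /(_ isT); lra.
Qed.

Lemma excess0 Q : excess [set 0] Q = area Q.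
Proof. by rewrite /excess msum0 area_set1_0 subr0. Qed.

(** Induction by cutting off ears.  The triangle [p t1 t2] contributes the [hwidth]
    of its three sides, and the excess of the cut, which is subtracted, is twice the
    [hwidth] of t1 - t2.  In total the term of the side (t2, t1) is replaced by those
    of (p, t1) and (t2, p), in accordance with [ear_sides]. *)
Lemma steiner_convex_position K s : sym_body K -> convex_position s ->
  s != [::] ->
  excess K (hull s) =
  area (hull s) + \sum_(e \in sides (hull s)) hwidth K (e.2 - e.1).
Proof.
move=> bK; rewrite -excess0; elim: s => // p s IHs cps _.
have cs := convex_position_behead cps.
have b0 := sym_body0.
case: (leqP (size s) 1) => [|s2]; last first.
  have [t1 [t2 et]] := ear_exists cps s2.
  have s0 : s != [::] by case: (s) s2.
  have [E1 E2 E3] := ear_cut et.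
  have [t1s t2s D0 _] := et.
  have D0' : det2 (t2 - p) (t1 - p) != 0 by rewrite det2_anti oppr_eq0 gt_eqF.
  have cut K' : sym_body K' -> excess K' (hull (p :: s)) =
      excess K' (hull s) + hwidth K' (t1 - p) + hwidth K' (p - t2) -
      hwidth K' (t1 - t2) + `|det2 (t2 - p) (t1 - p)| / 2.
    move=> bK'; have := excess_cut bK' (t1 - t2) (det2 (t1 - t2) t1)
      (@hull_compact R (p :: s)) (@hull_convex R (p :: s)).
    rewrite E1 E2 E3 excess_segment// excess_trapezoid//.
    have -> : t2 - p + (0 - 1) *: (t1 - p) = - (t1 - t2).
      by plane_ring.
    have -> : p - t2 = - (t2 - p) by rewrite opprB.
    by rewrite -(opprB t1 t2) !hwidthN//; lra.
  rewrite (cut _ bK) (cut _ b0) !hwidth_set0 IHs//.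
  have [S1 S2 S3 S4] := ear_sides cps et.
  rewrite (fsbigD1 (t2, t1) (sides (hull s)))//; last exact: sides_finite_convex_position.
  rewrite (fsbigD1 (p, t1) (sides (hull (p :: s))))//; last first.
    exact: sides_finite_convex_position.
  rewrite (fsbigD1 (t2, p) (sides (hull (p :: s)) `\ (p, t1)))//; last 2 first.
  - by apply: finite_setD; exact: sides_finite_convex_position.
  - by split => // -[_ pt]; move: D0; rewrite pt subrr /det2 /=; lra.
  rewrite S4 /=; move: (\sum_(_ \in _) _) => S; lra.
case: s cps cs {IHs} => [|q [|//]] cps cs _.
  rewrite hull1.
  rewrite -segmentxx.
  rewrite !excess_segment// hwidth_set0 subrr.
  have -> : hwidth K 0 = 0 by rewrite -(scale0r (0 : plane R)) hwidthZ// mul0r.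
  rewrite mulr0 add0r (_ : sides _ = set0) ?fsbig_set0//.
  apply/seteqP; split => // -[u v] [/= uv [+ _] [+ _] _].
  by rewrite segmentxx => uE vE; apply: uv; rewrite uE vE.
have pq : p <> q by case: cps => /=; rewrite inE => /andP[/eqP].
have -> : \sum_(e \in sides (hull [:: p; q])) hwidth K (e.2 - e.1) =
    2 * hwidth K (q - p).
  have sE : sides (hull [:: p; q]) = [set (p, q)] `|` [set (q, p)].
    apply/seteqP; split => -[u v].
      move=> /(sides_hull _ _ cps)[uv]; rewrite !inE => + + _.
      by move=> /orP[]/eqP uE /orP[]/eqP vE; rewrite uE vE in uv *; [|left|right|].
    have H x y : x <> y -> x \in [:: p; q] -> y \in [:: p; q] ->
        (forall z, z \in [:: p; q] -> z = x \/ z = y) ->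
        sides (hull [:: p; q]) (x, y).
      move=> xy xs ys zs; apply/(sides_hull _ _ cps); split => // z /zs[] ->.
        by rewrite subrr /det2 /=; lra.
      by rewrite det2xx.
    move=> [] [-> ->]; apply: H; rewrite ?inE ?eqxx ?orbT//.
    - by move=> z; rewrite !inE => /orP[]/eqP; [left|right].
    - by move=> /esym.
    - by move=> z; rewrite !inE => /orP[]/eqP; [right|left].
  rewrite sE fsbigU0//=; last first.
    by move=> _ [/= -> [/pq]].
  rewrite !fsbig_set1 /= -(opprB q p) hwidthN//; lra.
by rewrite hull2 !excess_segment// hwidth_set0; lra.
Qed.

(** The sum is the perimeter of the polygon in the norm [hwidth K], so this identifies
    twice the mixed area.  For a segment both orientations occur among the sides, and
    the formula holds in this case as well. *)
Theorem steiner K s : sym_body K -> s != [::] ->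
  area (msum (hull s) K) =
  area (hull s) + area K + \sum_(e \in sides (hull s)) hwidth K (e.2 - e.1).
Proof.
move=> bK s0; have [s' cs' E] := convex_position_exists s.
have s'0 : s' != [::].
  apply: contraNneq s0 => s'E; move: E; rewrite s'E hull_nil.
  case: (s) => // p r E; have : hull (p :: r) p by apply: mem_hull; rewrite mem_head.
  by rewrite -E.
have := steiner_convex_position bK cs' s'0; rewrite E /excess.
by move: (\sum_(_ \in _) _) => S; lra.
Qed.

End Steiner.

(** * Circumscribed parallelograms *)

Section Circumscribed.
Context {R : realType}.
Implicit Types (A B K Q M P : set (plane R)) (x y z p q u v e : plane R).

(** If the ball of radius [r] about [x] lies in [K], then so does the ball of radius
    r / 2 about the midpoint of [x] and [- x]. *)
Lemma sym_body_ball K : convex_domain K -> o_symmetric K ->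
  exists2 r : R, 0 < r & forall v, `|v| < r -> K v.
Proof.
move=> [cK /convexP vK [x Kx]] KN.
have /nbhs_ballP[r /= r0 xr] : nbhs x K by exact: Kx.
have xK : K x by apply: xr; exact: ballxx.
exists (r / 2); first by rewrite divr_gt0.
move=> v vr.
have -> : v = (1 - 2^-1) *: (- x) + 2^-1 *: (x + 2 *: v).
  by plane_field.
apply: vK; [by rewrite invr_ge0 ler0n invf_le1 ?ler1n| |].
  exact: (o_symmetricN KN).
apply: xr; rewrite -ball_normE /= opprD addNKr normrN normrZ.
by rewrite ger0_norm// -ltr_pdivlMl// mulrC.
Qed.

Lemma convex_domain_sym_body K : convex_domain K -> o_symmetric K -> sym_body K.
Proof.
move=> [cK vK [x Kx]] KN; split => //; exists x; exact: interior_subset.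
Qed.

Lemma interior_shrink K v k (t : R) : convex_domain K -> o_symmetric K ->
  K k -> `|t| < 1 -> (translate v K)° (v + t *: k).
Proof.
move=> dK KN Kk t1; have [r r0 rK] := sym_body_ball dK KN.
have [_ /convexP vK _] := dK.
have t0 : 0 < 1 - `|t| by rewrite subr_gt0.
suff: nbhs (v + t *: k) (translate v K) by [].
apply/nbhs_ballP; exists ((1 - `|t|) * r); first by rewrite /= mulr_gt0.
move=> y; rewrite -ball_normE /= => yr; exists (y - v); last by rewrite addrC subrK.
have [k' Kk' tk] : exists2 k', K k' & t *: k = `|t| *: k'.
  have [tp|tn] := leP 0 t; first by exists k; rewrite ?ger0_norm.
  by exists (- k); [exact: (o_symmetricN KN)|rewrite ltr0_norm// scalerN scaleNr opprK].
pose z := (1 - `|t|)^-1 *: (y - v - t *: k).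
have -> : y - v = (1 - (1 - `|t|)) *: k' + (1 - `|t|) *: z.
  by rewrite /z scalerA divff ?gt_eqF// scale1r subKr -tk [RHS]addrC subrK.
apply: vK => //.
  by rewrite (ltW t0)/= gerBl.
apply: rK; rewrite /z normrZ gtr0_norm ?invr_gt0// ltr_pdivrMl//.
have -> : y - v - t *: k = - (v + t *: k - y) by rewrite opprB opprD addrA.
by rewrite normrN.
Qed.

Section Domain.
Variable K : set (plane R).
Hypothesis dK : convex_domain K.
Hypothesis KN : o_symmetric K.

Let bK := convex_domain_sym_body dK KN.

Lemma hwidth_gt0 d : d <> 0 -> 0 < hwidth K d.
Proof.
move=> d0; have [r r0 rK] := sym_body_ball dK KN.
pose w : plane R := (- d.2, d.1).
have w0 : 0 < `|w|.
  rewrite normr_gt0; apply/eqP => -[/eqP]; rewrite oppr_eq0 => /eqP d2 d1.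
  by apply: d0; apply: injective_projections.
have Kw : K ((r / 2 / `|w|) *: w).
  apply: rK; rewrite normrZ ger0_norm ?divr_ge0 ?ltW ?divr_gt0// divfK ?gt_eqF//.
  lra.
apply: lt_le_trans (hwidth_ge bK d Kw).
rewrite det2Zr mulr_gt0 ?divr_gt0//.
have -> : det2 d w = d.1 ^+ 2 + d.2 ^+ 2 by rewrite /det2 /=; ring.
exact: sqr_norm_gt0.
Qed.

Lemma area_parallelogram p u v : area (parallelogram p u v) = `|det2 u v|.
Proof.
have := excess_parallelogram sym_body0 p u v.
by rewrite excess0 !hwidth_set0 !mulr0 !add0r.
Qed.

(** The parallelogram circumscribed about [K] with sides parallel to [d] and [u] has
    area 4 w(d) w(u) / |det2 d u|, where w = [hwidth K]. *)
Lemma circumscribed_area_le sqK d u : min_circumscribed_parallelogram K sqK ->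
  area sqK * `|det2 d u| <= 4 * hwidth K d * hwidth K u.
Proof.
move=> [_ sqmin].
(* Neither side changes when [u] is replaced by [- u]. *)
wlog D0 : u / 0 < det2 d u.
  move=> H; have [D0|D0|D0] := ltgtP 0 (det2 d u); first exact: H.
    by have := H (- u); rewrite det2Nr oppr_gt0 D0 normrN hwidthN//; apply.
  by rewrite -D0 normr0 mulr0 !mulr_ge0 ?hwidth_ge0.
rewrite gtr0_norm//; set D := det2 d u in D0 *.
have d0 : d <> 0 by move=> E; move: D0; rewrite /D E /det2 /= !mul0r subrr ltxx.
have u0 : u <> 0 by move=> E; move: D0; rewrite /D E /det2 /= !mulr0 subrr ltxx.
have [wd0 wu0] := (hwidth_gt0 d0, hwidth_gt0 u0).
pose A := hwidth K u / D; pose B := hwidth K d / D.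
have A0 : 0 < A by rewrite divr_gt0.
have B0 : 0 < B by rewrite divr_gt0.
have ABD0 : 0 < 2 * A * (2 * B * D).
  by apply: mulr_gt0; apply: mulr_gt0 => //; apply: mulr_gt0.
pose p := - (A *: d + B *: u); pose U := (2 * A) *: d; pose V := (2 * B) *: u.
(* The coordinates of [k] in the parallelogram, which range over the unit
   interval. *)
pose s k : R := (1 - det2 u k / hwidth K u) / 2.
pose t k : R := (1 + det2 d k / hwidth K d) / 2.
have kE k : k = p + s k *: U + t k *: V.
  rewrite [LHS](@det2_coordinates R d u k) ?gt_eqF// -/D.
  apply: injective_projections; rewrite /p /U /V /s /t /A /B /= /GRing.scale /=.
    by rewrite (det2_anti k u); field; rewrite !gt_eqF.
  by rewrite (det2_anti k u); field; rewrite !gt_eqF.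
have s01 k : K k -> 0 <= s k <= 1.
  move=> Kk; have := hwidth_ge bK u Kk; have := hwidth_le bK u Kk => l1 l2.
  have : -1 <= det2 u k / hwidth K u <= 1.
    by rewrite ler_pdivlMr// ler_pdivrMr// mulN1r mul1r l1.
  by move=> /andP[? ?]; rewrite /s; apply/andP; split; lra.
have t01 k : K k -> 0 <= t k <= 1.
  move=> Kk; have := hwidth_ge bK d Kk; have := hwidth_le bK d Kk => l1 l2.
  have : -1 <= det2 d k / hwidth K d <= 1.
    by rewrite ler_pdivlMr// ler_pdivrMr// mulN1r mul1r l1.
  by move=> /andP[? ?]; rewrite /t; apply/andP; split; lra.
have circ : circumscribed_parallelogram K (parallelogram p U V).
  exists p, U, V; split => //.
  - by rewrite /U /V det2Zl det2Zr -/D gt_eqF.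
  - by move=> k Kk; exists (s k), (t k); split; [exact: s01|exact: t01|exact: kE].
  have [k1 K1 E1] := hwidth_max bK u; have [k2 K2 E2] := hwidth_min bK u.
  have [k3 K3 E3] := hwidth_max bK d; have [k4 K4 E4] := hwidth_min bK d.
  split.
  - exists k4; split => //; exists (s k4); first exact: s01.
    rewrite [LHS]kE; have -> : t k4 = 0.
      by rewrite /t E4 mulNr divff ?gt_eqF// subrr mul0r.
    by plane_ring.
  - exists k1; split => //; exists (t k1); first exact: t01.
    rewrite [LHS]kE; have -> : s k1 = 0 by rewrite /s E1 divff ?gt_eqF// subrr mul0r.
    by plane_ring.
  - exists k2; split => //; exists (t k2); first exact: t01.
    rewrite [LHS]kE; have -> : s k2 = 1.
      by rewrite /s E2 mulNr divff ?gt_eqF// opprK divff.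
    by plane_ring.
  - exists k3; split => //; exists (s k3); first exact: s01.
    rewrite [LHS]kE; have -> : t k3 = 1 by rewrite /t E3 divff ?gt_eqF// divff.
    by plane_ring.
have := sqmin _ circ; rewrite area_parallelogram /U /V det2Zl det2Zr -/D.
rewrite gtr0_norm// => le1.
rewrite -ler_pdivlMr//; apply: le_trans le1 _.
by apply: eq_ler; rewrite /A /B; field; rewrite gt_eqF.
Qed.

(** Put mu = 4 w(e) / area sq.  If [e] were not in mu K, a line of some direction [d]
    would separate it from mu K, that is |det2 d e| > mu w(d), which contradicts
    [circumscribed_area_le] for [d] and [e]. *)
Lemma knorm_le_hwidth sqK e : min_circumscribed_parallelogram K sqK ->
  area sqK * knorm K e <= 4 * hwidth K e.
Proof.
move=> sqmin; have [cK /convexP vK KN' K0] := bK.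
have := area_ge0 sqK; rewrite le_eqVlt => /orP[/eqP <-|a0].
  by rewrite mul0r mulr_ge0 ?hwidth_ge0.
rewrite mulrC -ler_pdivlMr//; set mu := 4 * _ / _.
have mu0 : 0 <= mu by rewrite divr_ge0 ?(ltW a0)// mulr_ge0 ?hwidth_ge0.
suff Ke : dilate mu K e by apply: ge_inf => //; exists 0 => x [].
apply: contrapT => Ke.
have cD : compact (dilate mu K).
  by apply: image_compact => // x; exact: scaler_continuous.
have vD : convex_set (dilate mu K).
  apply/convexP => _ _ t t01 [x Kx <-] [y Ky <-].
  exists ((1 - t) *: x + t *: y); first exact: vK.
  by plane_ring.
have [|d dP] := separation cD vD _ Ke.
  by have [k Kk] := K0; exists (mu *: k), k.
have [k Kk kE] := hwidth_min bK d.
have /dP : dilate mu K (mu *: k) by exists k.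
rewrite det2Zr kE => de.
have := circumscribed_area_le d e sqmin.
rewrite leNgt => /negP; apply.
have de' : mu * hwidth K d < `|det2 d e|.
  by rewrite ltr_normr; apply/orP; right; rewrite ltrNr -mulrN.
rewrite -ltr_pdivrMl//; apply: le_lt_trans de'.
by apply: eq_ler; rewrite /mu; field; rewrite gt_eqF.
Qed.

End Domain.

End Circumscribed.

(** * Totally separable packings *)

Section Separable.
Context {R : realType}.
Implicit Types (A B K Q M P : set (plane R)) (x y z p q u v e : plane R).

Lemma closed_halfplane_le e (c : R) : closed [set x | det2 e x <= c].
Proof. by have [] := halfplane_closed e c. Qed.

Lemma closed_halfplane_ge e (c : R) : closed [set x | c <= det2 e x].
Proof. by have [] := halfplane_closed e c. Qed.

Lemma closed_det2_line e (c : R) : closed [set x | det2 e x = c].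
Proof. by have [] := halfplane_closed e c. Qed.

Lemma halfplane_le_convex e (c : R) : convex_set [set x | det2 e x <= c].
Proof.
apply/convexP => x y t /andP[t0 t1] /= cx cy.
by rewrite det2Dr !det2Zr; nra.
Qed.

Lemma convex_setI A B : convex_set A -> convex_set B -> convex_set (A `&` B).
Proof.
move=> /convexP vA /convexP vB; apply/convexP => x y t t01 [Ax Bx] [Ay By].
by split; [exact: vA|exact: vB].
Qed.

Lemma compact_chord (C : set (plane R)) d (b : R) : compact C -> C !=set0 -> d <> 0 ->
  (forall x, C x -> det2 d x = b) ->
  exists p (al : R), [/\ 0 <= al, C p, C (p + al *: d) &
    C `<=` segment p (p + al *: d)].
Proof.
move=> cC C0 d0 Cb.
pose d' : plane R := (d.2, - d.1).
have [p Cp pmin] := det2_min d' cC C0; have [q Cq qmax] := det2_max d' cC C0.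
have N0 := sqr_norm_gt0 d0.
set N := d.1 ^+ 2 + d.2 ^+ 2 in N0.
have on_line x : C x -> x = p + ((det2 d' x - det2 d' p) / N) *: d.
  move=> Cx; apply/eqP; rewrite -subr_eq0; apply/eqP/(det2_dot_eq0 d0).
    by rewrite det2Dr det2Nr det2Dr det2Zr det2xx mulr0 addr0 !Cb// subrr.
  rewrite /N /d' /dot /det2 /= /GRing.scale /=.
  by field; rewrite -/N gt_eqF.
pose al := (det2 d' q - det2 d' p) / N.
have al0 : 0 <= al by rewrite divr_ge0 ?(ltW N0)// subr_ge0 pmin.
exists p, al; split => //; first by rewrite -on_line.
move=> x Cx; have [pq|pq] := eqVneq (det2 d' q) (det2 d' p).
  exists 0; first by rewrite lexx ler01.
  rewrite subr0 scale1r scale0r addr0 [LHS]on_line//.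
  have -> : det2 d' x = det2 d' p by apply/eqP; rewrite eq_le pmin// -pq qmax.
  by rewrite subrr mul0r scale0r addr0.
have pq0 : 0 < det2 d' q - det2 d' p by rewrite subr_gt0 lt_neqAle eq_sym pq pmin.
exists ((det2 d' x - det2 d' p) / (det2 d' q - det2 d' p)).
  rewrite divr_ge0 ?(ltW pq0) ?subr_ge0 ?pmin//= ler_pdivrMr// mul1r lerD2r.
  exact: qmax.
rewrite [LHS]on_line// /al.
by plane_field; rewrite !gt_eqF.
Qed.

(** The excess is additive for the two cuts along the boundary lines of the strip, up
    to the excess of the chords.  The middle part contains the trapezoid spanned by
    the chords.  Since the strip is as wide as [K], the parallel sides of
    the trapezoid contribute as much as the chords, and each leg, which crosses the
    strip, contributes at least area sq / 2 by [circumscribed_area_le]. *)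
Lemma excess_strip K sqK Q d (b : R) x y :
  convex_domain K -> o_symmetric K -> min_circumscribed_parallelogram K sqK ->
  compact Q -> convex_set Q -> d <> 0 ->
  Q x -> det2 d x <= b - hwidth K d ->
  Q y -> b + hwidth K d <= det2 d y ->
  excess K (Q `&` [set x | det2 d x <= b - hwidth K d]) +
  excess K (Q `&` [set x | b + hwidth K d <= det2 d x]) + area sqK <=
  excess K Q.
Proof.
move=> dK KN sqmin cQ vQ d0 Qx xb Qy yb.
have bK := convex_domain_sym_body dK KN.
have h0 := hwidth_gt0 dK KN d0.
move: (erefl (hwidth K d)) h0 xb yb.
(* From here on the half width is an abstract number [h]. *)
move: {-1}(hwidth K d) => h hE h0 xb yb.
have crossing (c : R) : b - h <= c <= b + h -> exists2 z, Q z & det2 d z = c.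
  move=> /andP[c1 c2].
  have xy : 0 < det2 d y - det2 d x by clear -xb yb h0; lra.
  have xc : 0 <= c - det2 d x by clear -xb c1; lra.
  have cy : c <= det2 d y by clear -yb c2; lra.
  exists ((1 - (c - det2 d x) / (det2 d y - det2 d x)) *: x +
          ((c - det2 d x) / (det2 d y - det2 d x)) *: y).
    move/convexP : vQ; apply; [|exact: Qx|exact: Qy].
    by rewrite divr_ge0 ?(ltW xy)//= ler_pdivrMr// mul1r lerD2r.
  by rewrite det2Dr !det2Zr; field; rewrite gt_eqF.
pose P := Q `&` [set x | b - h <= det2 d x].
have cP : compact P by apply: compact_closedI cQ _; exact: closed_halfplane_ge.
have vP : convex_set P by apply: convex_setI vQ _; exact: halfplane_convex.
pose S := P `&` [set x | det2 d x <= b + h].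
pose s1 := Q `&` [set x | det2 d x = b - h].
pose s2 := P `&` [set x | det2 d x = b + h].
have cs1 : compact s1 by apply: compact_closedI cQ _; exact: closed_det2_line.
have cs2 : compact s2 by apply: compact_closedI cP _; exact: closed_det2_line.
have [|p [al [al0 [Qp /= pb] [Qp' _] s1p]]] :=
  @compact_chord s1 d (b - h) cs1 _ d0 (fun x => @proj2 _ _).
  have [|z Qz zb] := crossing (b - h); last by exists z.
  by apply/andP; split; clear -h0; lra.
have [|q [be [be0 [[Qq _] /= qb] [[Qq' _] _] s2q]]] :=
  @compact_chord s2 d (b + h) cs2 _ d0 (fun x => @proj2 _ _).
  have [|z Qz zb] := crossing (b + h); first by apply/andP; split; clear -h0; lra.
  exists z; split; last exact: zb.
  by split; [exact: Qz|rewrite /=; clear -zb h0; lra].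
have le1 : excess K s1 <= al * (2 * h).
  apply: (le_trans (excess_le bK cs1 (@plane_segment_compact R _ _) s1p)).
  rewrite excess_segment// addrAC subrr add0r hwidthZ// hE.
  by apply: eq_ler; ring.
have le2 : excess K s2 <= be * (2 * h).
  apply: (le_trans (excess_le bK cs2 (@plane_segment_compact R _ _) s2q)).
  rewrite excess_segment// addrAC subrr add0r hwidthZ// hE.
  by apply: eq_ler; ring.
pose u := q - p.
have duE : det2 d u = 2 * h by rewrite /u det2Dr det2Nr pb qb; ring.
have udN : `|det2 u d| = 2 * h by rewrite det2_anti normrN duE gtr0_norm// mulr_gt0.
have ud0 : det2 u d != 0 by rewrite -normr_gt0 udN mulr_gt0.
have le3 : excess K (trapezoid p u d al be) <= excess K S.
  apply: excess_le => //; first exact: trapezoid_compact.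
    by apply: compact_closedI => //; exact: closed_halfplane_le.
  move=> _ [s [r [/andP[s0 s1'] /andP[r0 r1] ->]]].
  have dE : det2 d (p + s *: u + r *: d) = b - h + s * (2 * h).
    by rewrite !det2Dr !det2Zr det2xx pb duE; ring.
  split; last by rewrite /= dE; clear -h0 s0 s1'; nra.
  split; last by rewrite /= dE; clear -h0 s0 s1'; nra.
  have in_seg z (k t : R) : Q z -> Q (z + k *: d) -> 0 <= t <= 1 -> Q (z + (t * k) *: d).
    move=> Qz Qz' t01; have -> : z + (t * k) *: d = (1 - t) *: z + t *: (z + k *: d).
      by plane_ring.
    by move/convexP : vQ; apply.
  pose m := (1 - s) * al + s * be.
  have [t t01 rE] : exists2 t : R, 0 <= t <= 1 & r = t * m.
    have [m0|m0] := eqVneq m 0.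
      exists 0; rewrite ?lexx ?ler01// mul0r; apply/eqP; rewrite eq_le r0 andbT.
      by rewrite -m0.
    have mgt0 : 0 < m by rewrite lt_neqAle eq_sym m0 (le_trans r0).
    exists (r / m); last by rewrite divfK.
    by rewrite divr_ge0 ?(ltW mgt0)//= ler_pdivrMr// mul1r.
  have -> : p + s *: u + r *: d =
      (1 - s) *: (p + (t * al) *: d) + s *: (q + (t * be) *: d).
    by rewrite rE /m /u; plane_ring.
  by move/convexP : (vQ); apply; [rewrite s0|exact: in_seg|exact: in_seg].
(* Applied to both legs of the trapezoid, which lead from one boundary line of the
   strip to the other. *)
have wide v : det2 d v = 2 * h -> area sqK <= 2 * hwidth K v.
  move=> dv; have := circumscribed_area_le dK KN d v sqmin.
  rewrite dv gtr0_norm ?mulr_gt0// hE => le4.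
  have : area sqK * (2 * h) <= (2 * hwidth K v) * (2 * h).
    by apply: (le_trans le4); apply: eq_ler; ring.
  by rewrite ler_pM2r// mulr_gt0.
have w1 := wide u duE.
have := wide (u + (be - al) *: d).
rewrite det2Dr det2Zr det2xx mulr0 addr0 => /(_ duE) w2.
move: le3; rewrite excess_trapezoid// udN hE => le3.
have half : 2 * h / 2 = h by field.
rewrite half in le3.
have := excess_cut bK d (b - h) cQ vQ; rewrite -/P -/s1 => cutQ.
have := excess_cut bK d (b + h) cP vP; rewrite -/S -/s2.
have -> : P `&` [set x | b + h <= det2 d x] = Q `&` [set x | b + h <= det2 d x].
  apply/seteqP; split => z; first by move=> [[]].
  move=> [Qz /= zb]; split; last exact: zb.
  by split; [exact: Qz|rewrite /=; clear -zb h0; lra].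
move=> cutP.
move: cutQ cutP le1 le2 le3 w1 w2.
move: (excess K Q) (excess K P) (excess K S) (excess K s1) (excess K s2) (area sqK).
move: (excess K (Q `&` _)) (excess K (Q `&` _)) (hwidth K u) (hwidth K _).
by move=> *; lra.
Qed.

(** A point of [K] where [det2 d] is maximal becomes interior when it is scaled by a
    factor of absolute value less than 1.  If the line were closer to [v] than half
    the width of [K], it would pass through such a point of the translate. *)
Lemma translate_side K v d (b : R) :
  convex_domain K -> o_symmetric K -> d <> 0 ->
  [set x | det2 d x = b] `&` (translate v K)° = set0 ->
  det2 d v <= b - hwidth K d \/ b + hwidth K d <= det2 d v.
Proof.
move=> dK KN d0 lineK; have bK := convex_domain_sym_body dK KN.
have h0 := hwidth_gt0 dK KN d0.
have [|lt1] := leP (det2 d v) (b - hwidth K d); first by left.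
have [|lt2] := leP (b + hwidth K d) (det2 d v); first by right.
exfalso; have [k Kk kE] := hwidth_max bK d.
pose t := (b - det2 d v) / hwidth K d.
have : ([set x | det2 d x = b] `&` (translate v K)°) (v + t *: k).
  split; first by rewrite /= det2Dr det2Zr kE /t divfK ?gt_eqF// addrC subrK.
  apply: interior_shrink => //.
  rewrite /t normrM normfV (gtr0_norm h0) ltr_pdivrMr// mul1r ltr_norml.
  by apply/andP; split; clear -lt1 lt2; lra.
by rewrite lineK.
Qed.

(** Induction on the number of centres: a separating line splits them into two
    nonempty groups, and [excess_strip] gains one more area sq. *)
Lemma excess_totally_separable K sqK (I : eqType) (c : I -> plane R)
    (r : seq I) :
  convex_domain K -> o_symmetric K -> min_circumscribed_parallelogram K sqK ->
  uniq r -> r != [::] ->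
  (forall i j, i \in r -> j \in r -> i <> j -> exists d (b : R),
    [/\ d <> 0, translate (c i) K `<=` [set x | det2 d x <= b],
        translate (c j) K `<=` [set x | b <= det2 d x] &
        forall k, [set x | det2 d x = b] `&` (translate (c k) K)° = set0]) ->
  (size r)%:R * area sqK <= excess K (hull [seq c i | i <- r]) + area sqK.
Proof.
move=> dK KN sqmin; have bK := convex_domain_sym_body dK KN.
have [n] := ubnP (size r); elim: n r => // n IHn r; rewrite ltnS => rn ur r0 sep.
case: r ur r0 rn sep => [//|i [|j r]].
  move=> _ _ _ _ /=; rewrite mul1r lerDr hull1.
  rewrite -segmentxx.
  by rewrite excess_segment// mulr_ge0// hwidth_ge0.
set s := [:: i, j & r] => us _ sn sep.
have is_ : i \in s by rewrite mem_head.
have js : j \in s by rewrite !inE eqxx orbT.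
have ij : i <> j.
  by move=> ij; move: us; rewrite /= ij inE eqxx.
have [d [b [d0 ib jb lineK]]] := sep i j is_ js ij.
have h0 := hwidth_gt0 dK KN d0.
have [k Kk kE] := hwidth_max bK d; have [k' Kk' k'E] := hwidth_min bK d.
have ib' : det2 d (c i) <= b - hwidth K d.
  have : det2 d (c i + k) <= b by apply: ib; exists k.
  by rewrite det2Dr kE lerBrDr.
have jb' : b + hwidth K d <= det2 d (c j).
  have : b <= det2 d (c j + k') by apply: jb; exists k'.
  by rewrite det2Dr k'E lerBrDr.
pose a l := det2 d (c l) <= b - hwidth K d.
have i1 : i \in seq.filter a s by rewrite mem_filter is_ andbT.
have j2 : j \in seq.filter (predC a) s.
  by rewrite mem_filter js andbT /= /a -ltNge; lra.
have nonempty t l : l \in t -> t != [::] :> seq I by case: t.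
have sizeE : size s = (size (seq.filter a s) + size (seq.filter (predC a) s))%N.
  by rewrite !size_filter count_predC.
have size1 : (0 < size (seq.filter a s))%N.
  by rewrite lt0n size_eq0 (nonempty _ _ i1).
have size2 : (0 < size (seq.filter (predC a) s))%N.
  by rewrite lt0n size_eq0 (nonempty _ _ j2).
have IH1 := IHn (seq.filter a s); have IH2 := IHn (seq.filter (predC a) s).
have {}IH1 : (size (seq.filter a s))%:R * area sqK <=
    excess K (hull [seq c i | i <- seq.filter a s]) + area sqK.
  apply: IH1; [|exact: filter_uniq|exact: nonempty i1|].
    by rewrite (leq_trans _ sn)// sizeE -addn1 leq_add2l.
  by move=> l m; rewrite !mem_filter => /andP[_ ls] /andP[_ ms]; exact: sep.
have {}IH2 : (size (seq.filter (predC a) s))%:R * area sqK <=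
    excess K (hull [seq c i | i <- seq.filter (predC a) s]) + area sqK.
  apply: IH2; [|exact: filter_uniq|exact: nonempty j2|].
    by rewrite (leq_trans _ sn)// sizeE addnC -addn1 leq_add2l.
  by move=> l m; rewrite !mem_filter => /andP[_ ls] /andP[_ ms]; exact: sep.
pose Q := hull [seq c i | i <- s].
have cQ : compact Q by exact: hull_compact.
have vQ : convex_set Q by exact: hull_convex.
have Qc l : l \in s -> Q (c l) by move=> ls; apply: mem_hull; exact: map_f.
have le1 : excess K (hull [seq c i | i <- seq.filter a s]) <=
    excess K (Q `&` [set x | det2 d x <= b - hwidth K d]).
  apply: excess_le => //; first exact: hull_compact.
    by apply: compact_closedI => //; exact: closed_halfplane_le.
  apply: chull_sub; first by apply: convex_setI => //; exact: halfplane_le_convex.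
  move=> _ /mapP[l + ->]; rewrite mem_filter => /andP[al ls].
  by split; [exact: Qc|].
have le2 : excess K (hull [seq c i | i <- seq.filter (predC a) s]) <=
    excess K (Q `&` [set x | b + hwidth K d <= det2 d x]).
  apply: excess_le => //; first exact: hull_compact.
    by apply: compact_closedI => //; exact: closed_halfplane_ge.
  apply: chull_sub; first by apply: convex_setI => //; exact: halfplane_convex.
  move=> _ /mapP[l + ->]; rewrite mem_filter => /andP[/negP al ls].
  split; first exact: Qc.
  by have [|//] := translate_side dK KN d0 (lineK l).
have := excess_strip dK KN sqmin cQ vQ d0 (Qc _ is_) ib' (Qc _ js) jb'.
rewrite -/Q sizeE natrD mulrDl => le3.
move: IH1 IH2 le1 le2 le3.
move: (excess K Q) (excess K (hull _)) (excess K (hull _)).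
move: (excess K _) (excess K _) (area sqK) (_ * _) (_ * _) => e1 e2 A x1 x2 E1 E2 E3.
by clear; lra.
Qed.

End Separable.

(** * Soft packings *)

Section Soft.
Context {R : realType}.
Implicit Types (A B K Q M P : set (plane R)) (x y z p q u v e : plane R).

Lemma sym_body_dilate K (t : R) : sym_body K -> 0 <= t -> sym_body (dilate t K).
Proof.
move=> [cK /convexP vK KN [k Kk]] t0; split.
- by apply: image_compact => // x; exact: scaler_continuous.
- apply/convexP => _ _ r r01 [x Kx <-] [y Ky <-].
  exists ((1 - r) *: x + r *: y); first exact: vK.
  by plane_ring.
- apply/seteqP; split => [_ [x Kx <-]|_ [_ [x Kx <-] <-]].
    exists (t *: - x); last by rewrite scalerN opprK.
    by exists (- x) => //; exact: o_symmetricN.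
  by exists (- x); [exact: o_symmetricN|rewrite scalerN].
- by exists (t *: k), k.
Qed.

(** The maximum of [det2 e] over the translate by [x] exceeds the one over [K] by
    [det2 e x], so the translate determines [x]. *)
Lemma translate_inj K x y : sym_body K -> translate x K = translate y K -> x = y.
Proof.
have le K' x' y' e : sym_body K' -> translate x' K' = translate y' K' ->
    det2 e x' <= det2 e y'.
  move=> bK E; have [k Kk kE] := hwidth_max bK e.
  have : translate x' K' (x' + k) by exists k.
  rewrite E => -[k' Kk' E'].
  have := hwidth_ge bK e Kk'.
  have : det2 e (x' + k) = det2 e (y' + k') by rewrite E'.
  by rewrite !det2Dr kE; lra.
move=> bK E; have det_eq e : det2 e x = det2 e y.
  by apply/eqP; rewrite eq_le; apply/andP; split; apply: le bK _.
apply: injective_projections.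
  by have := det_eq (0, -1); rewrite /det2 /=; lra.
by have := det_eq (1, 0); rewrite /det2 /=; lra.
Qed.

Lemma hull_translates (I : finType) (c : I -> plane R) K : convex_set K ->
  chull (\bigcup_i translate (c i) K) = msum (hull [seq c i | i <- enum I]) K.
Proof.
move=> vK; apply/seteqP; split.
  apply: chull_sub; first by apply: msum_convex => //; exact: hull_convex.
  move=> _ [i _ [k Kk <-]]; exists (c i); last by exists k.
  by apply: mem_hull; apply: map_f; rewrite mem_enum.
move=> _ [q Qq [k Kk <-]].
suff : hull [seq c i | i <- enum I] `<=`
  [set x | chull (\bigcup_i translate (c i) K) (x + k)] by exact.
apply: chull_sub.
  apply/convexP => x y t t01 /= hx hy.
  have -> : (1 - t) *: x + t *: y + k = (1 - t) *: (x + k) + t *: (y + k).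
    by plane_ring.
  by have /convexP := @chull_convex R (\bigcup_i translate (c i) K); apply.
by move=> _ /= /mapP[i _ ->]; apply: sub_chull; exists i => //; exists k.
Qed.

Lemma sides_hull_finite (s : seq (plane R)) : finite_set (sides (hull s)).
Proof.
have [s' cs' <-] := convex_position_exists s; exact: sides_finite_convex_position.
Qed.

End Soft.

Theorem theorem5 (R : realType) (K : set (plane R)) (n : nat) (lambda : R)
    (c : 'I_n -> plane R) (sqK : set (plane R)) :
  convex_domain K -> o_symmetric K ->
  (1 < n)%N -> 0 <= lambda ->
  min_circumscribed_parallelogram K sqK ->
  sep_soft_packings K lambda (fun i => translate (c i) (soft lambda K)) ->
  area (chull (\bigcup_i translate (c i) (soft lambda K))) >=
    (n%:R - 1) * area sqK + 2 * lambda * mixed_area (chull (range c)) K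
      + (1 + lambda) ^+ 2 * area K
  /\
  (n%:R - 1) * area sqK + 2 * lambda * mixed_area (chull (range c)) K
      + (1 + lambda) ^+ 2 * area K >=
    (n%:R - 1 + lambda / 4 * mperimeter K (chull (range c))) * area sqK
      + (1 + lambda) ^+ 2 * area K.
Proof.
move=> dK KN n1 l0 sqmin [c' [_ sepc'] cE].
have bK := convex_domain_sym_body dK KN.
have t0 : 0 <= 1 + lambda by rewrite addr_ge0.
have bL : sym_body (soft lambda K) by exact: sym_body_dilate.
have {cE} cc' : c' = c.
  apply/funext => i; apply: (translate_inj bL).
  exact: (congr1 (fun f => f i) cE).
rewrite cc' in sepc'.
pose s := [seq c i | i <- enum 'I_n].
have size_s : size s = n by rewrite size_map size_enum_ord.
have s0 : s != [::] by rewrite -size_eq0 size_s -lt0n ltnW.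
have -> : chull (range c) = hull s.
  congr chull; apply/seteqP; split => [_ [i _ <-]|x /mapP[i _ ->]]; last by exists i.
  by apply: map_f; rewrite mem_enum.
have [cL vL _ _] := bL; have [cK _ _ _] := bK.
rewrite hull_translates// /mixed_area (steiner bK s0) (steiner bL s0).
rewrite area_dilate//; last by rewrite gt_eqF// ltr_wpDr.
set W := \sum_(e \in sides (hull s)) hwidth K _.
have fin := sides_hull_finite s.
have -> : \sum_(e \in sides (hull s)) hwidth (soft lambda K) (e.2 - e.1) =
    (1 + lambda) * W.
  rewrite fsbig_distrr//; apply: eq_fsbigr => e _; exact: hwidth_dilate.
have W_ge : mperimeter K (hull s) * area sqK <= 4 * W.
  rewrite mulrC /mperimeter fsbig_distrr// /W fsbig_distrr//.
  rewrite !fsbig_finite//; apply: ler_sum => e _; exact: knorm_le_hwidth.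
have n_le : n%:R * area sqK <= area (hull s) + W + area sqK.
  have := @excess_totally_separable R K sqK 'I_n c (enum 'I_n) dK KN sqmin (enum_uniq _).
  rewrite size_enum_ord -/s /excess (steiner bK s0) -/W => H.
  have -> : area (hull s) + W = area (hull s) + area K + W - area K by ring.
  apply: H; first by rewrite -size_eq0 size_enum_ord -lt0n ltnW.
  move=> i j _ _ ij; have [a [b [a0 ia ja line0]]] := sepc' i j ij.
  (* The normal vector of the line is turned into its direction. *)
  have aE x : det2 (a.2, - a.1) x = dot a x by rewrite /det2 /dot /=; ring.
  exists (a.2, - a.1), b; split.
  - move=> [/eqP a2 /eqP]; rewrite oppr_eq0 => /eqP a1.
    by apply: a0; apply: injective_projections => //; apply/eqP.
  - by move=> x /ia; rewrite /= aE.
  - by move=> x /ja; rewrite /= aE.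
  - move=> k; rewrite -(line0 k); congr (_ `&` _).
    by apply/seteqP; split => x; rewrite /line /= aE.
have p2 : 2 * lambda *
    ((area (hull s) + area K + W - area (hull s) - area K) / 2) = lambda * W.
  by field.
rewrite p2; split.
  rewrite mulrBl mul1r; move: n_le.
  move: (area _) (area _) (area _) (n%:R * _) => a1 a2 a3 a4.
  by clear; lra.
rewrite lerD2r mulrDl lerD2l -(mulrA (_ / _)).
have -> : lambda * W = lambda / 4 * (4 * W) by field.
by rewrite ler_wpM2l// divr_ge0.
Qed.
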